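(* There is an absolute constant $C$ such that the following holds. Let $v_0\in\mathbb{R}^n$ be a unit vector, $\epsilon>0$, $\tau\ge C n^{3/4}(\log n)^{1/4}/\epsilon$, and let $\mathbf{A}$ be an $n\times n\times n$ tensor with independent $\mathcal{N}(0,1)$ entries. Let $\mathbf{T}=\tau v_0^{\otimes 3}+\mathbf{A}$ and $\mathbf{T}'=\tau v_0^{\otimes 3}+\frac{1}{6}\sum_{\pi\in\mathcal{S}_3}\mathbf{A}^\pi$. With probability $1-O(n^{-10})$ over $\mathbf{A}$, the following holds for both $\mathbf{S}\in\{\mathbf{T},\mathbf{T}'\}$: for every degree-$4$ pseudo-expectation $\tilde{\mathbb{E}}$ satisfying $\{\|x\|^2=1\}$ that maximizes $\tilde{\mathbb{E}}\,\mathbf{S}(x)$ over all such pseudo-expectations, the vector $v=\tilde{\mathbb{E}}x/\|\tilde{\mathbb{E}}x\|$ satisfies $\langle v,v_0\rangle\ge 1-O(\epsilon)$.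
   Context: For a 3-tensor $\mathbf{S}$, $\mathbf{S}(x)=\sum_{i,j,k}\mathbf{S}_{ijk}x_ix_jx_k$. For $\pi\in\mathcal{S}_3$, $\mathbf{A}^\pi$ is the tensor with indices permuted by $\pi$: $\mathbf{A}^\pi_\alpha=\mathbf{A}_{\pi^{-1}(\alpha)}$. A degree-$d$ pseudo-expectation ($d$ even) is a linear functional $\tilde{\mathbb{E}}:\mathbb{R}[x]_{\le d}\to\mathbb{R}$ with $\tilde{\mathbb{E}}\,1=1$ and $\tilde{\mathbb{E}}\,p(x)^2\ge 0$ for all $p$ of degree $\le d/2$; it satisfies $\{p=0\}$ if $\tilde{\mathbb{E}}\,pq=0$ for all $q$ with $\deg(pq)\le d$. $\tilde{\mathbb{E}}x$ denotes the vector $(\tilde{\mathbb{E}}x_i)_i$. *)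

(* Defs.v *)
From HB Require Import structures.
From mathcomp Require Import all_boot all_order all_algebra all_fingroup.
From mathcomp Require Import mpoly.
From mathcomp Require Import all_classical all_reals all_analysis.

Set Implicit Arguments.
Unset Strict Implicit.
Unset Printing Implicit Defensive.

Import Order.TTheory GRing.Theory Num.Theory.

Local Open Scope classical_set_scope.
Local Open Scope ring_scope.

Definition mutually_independent (d : measure_display) (T : measurableType d)
    (R : realType) (P : probability T R) (I : finType) (X : I -> T -> R) : Prop :=
  forall (J : {set I}) (B : I -> set R), (forall i, measurable (B i)) ->
    P (\bigcap_(i in [set i | i \in J]) (X i @^-1` B i)) =
    ((\prod_(i in J) fine (P (X i @^-1` B i)))%R)%:E.

Definition tensor3 (R : Type) (n : nat) := 'I_n -> 'I_n -> 'I_n -> R.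

(** A^pi_alpha = A_{pi^{-1}(alpha)}, where pi^{-1} acts on the index triple
    alpha = (alpha_0, alpha_1, alpha_2) by (pi^{-1} alpha)_t = alpha_{pi t}. *)
Definition tensor_perm (R : Type) (n : nat) (A : tensor3 R n) (s : 'S_3)
    : tensor3 R n :=
  fun i j k =>
    let a := [tuple i; j; k] in
    A (tnth a (s (inord 0))) (tnth a (s (inord 1))) (tnth a (s (inord 2))).

Definition spiked (R : ringType) (n : nat) (tau : R) (v0 : 'I_n -> R)
    (A : tensor3 R n) : tensor3 R n :=
  fun i j k => tau * v0 i * v0 j * v0 k + A i j k.

Definition spiked_sym (R : fieldType) (n : nat) (tau : R) (v0 : 'I_n -> R)
    (A : tensor3 R n) : tensor3 R n :=
  fun i j k => tau * v0 i * v0 j * v0 k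
               + 6%:R^-1 * \sum_(s : 'S_3) tensor_perm A s i j k.

Definition tensor_poly (R : comRingType) (n : nat) (S : tensor3 R n)
    : {mpoly R[n]} :=
  \sum_(i < n) \sum_(j < n) \sum_(k < n) S i j k *: ('X_i * 'X_j * 'X_k).

Definition sphere_poly (R : comRingType) (n : nat) : {mpoly R[n]} :=
  \sum_(i < n) 'X_i ^+ 2 - 1.

(** total degree of p is <= d  (msize p = 1 + total degree, msize 0 = 0) *)
Definition deg_le (R : comRingType) (n : nat) (d : nat) (p : {mpoly R[n]}) :=
  (msize p <= d.+1)%N.

(** A degree-d pseudo-expectation: a functional that is linear on
    R[x]_{<=d} (its values on higher-degree polynomials are irrelevant),
    normalized, and nonnegative on squares of polynomials of degree <= d/2. *)
Definition pseudo_expectation (R : realFieldType) (n d : nat)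
    (E : {mpoly R[n]} -> R) : Prop :=
  [/\ (forall p q, deg_le d p -> deg_le d q -> E (p + q) = E p + E q),
      (forall (c : R) p, deg_le d p -> E (c *: p) = c * E p),
      E 1 = 1 &
      (forall p, deg_le (d %/ 2) p -> 0 <= E (p ^+ 2))].

Definition pe_satisfies (R : realFieldType) (n d : nat)
    (E : {mpoly R[n]} -> R) (p : {mpoly R[n]}) : Prop :=
  forall q, deg_le d (p * q) -> E (p * q) = 0.

Definition pe_mean (R : realFieldType) (n : nat) (E : {mpoly R[n]} -> R)
    : 'I_n -> R :=
  fun i => E 'X_i.

Definition dotv (R : ringType) (n : nat) (u w : 'I_n -> R) : R :=
  \sum_(i < n) u i * w i.

Definition normv (R : rcfType) (n : nat) (u : 'I_n -> R) : R :=
  Num.sqrt (dotv u u).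

Definition normalize (R : rcfType) (n : nat) (u : 'I_n -> R) : 'I_n -> R :=
  fun i => u i / normv u.

(* Main.v *)
(* The symmetrized tensor defines the same cubic as T, so one cubic S(x) =
   tau <x, v0>^3 + A(x) is at stake.  The key bound is E A(x) <= B = O(n^(3/4)) for
   every degree-4 pseudo-expectation E on the sphere.  Comparing a maximizer with
   evaluation at v0 (and bounding A(v0) by evaluation at - v0) then gives
   E <x, v0>^3 >= 1 - 2 B / tau, and E <x, v0> >= 1 - O(B / tau) follows from
   E |x - v0|^2 (2 <x, v0> + 1)^2 >= 0.

   Write A(x) = sum_i x_i q_i(x).  By Cauchy-Schwarz it suffices to bound
   E sum_i q_i^2 = sum_(i,j,j',k,k') A_ijk A_ij'k' E x_j x_j' x_k x_k'.  Moment
   matrices are Gram matrices of trace 1, so this reduces to operator norms.  The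
   terms j = j' are O(n) because the injective norm of A is O(sqrt n).  The terms
   j != j' are 4 times the average over J of those with j in J and j' not in J;
   such a bilinear form in independent halves of A is, given the second half, a
   Gaussian whose variance at unit matrices u, v is O(n), again by the injective
   norm.  A union bound over nets of size exp (O(n^2)) and over the 2^n sets J
   gives operator norm O(n^(3/2)) with exponentially small failure probability. *)

Require Import Defs.
From HB Require Import structures.
From mathcomp Require Import all_boot all_order all_algebra all_fingroup.
From mathcomp Require Import mpoly.
From mathcomp Require Import all_classical all_reals all_analysis.
From mathcomp Require Import measurable_realfun measurable_fun_approximation.
From mathcomp Require Import ring lra zify.
Set Implicit Arguments.
Unset Strict Implicit.
Unset Printing Implicit Defensive.

Import Order.TTheory GRing.Theory Num.Theory.
Local Open Scope classical_set_scope.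
Local Open Scope ring_scope.

(** * Tails of decoupled Gaussian forms *)

(** The Radon-Nikodym derivative of [normal_prob 0 1] agrees almost everywhere with the density,
    since both have the same integral over every measurable set. *)
Lemma ge0_integral_normal_prob (R : realType) (f : R -> \bar R) :
  measurable_fun [set: R] f -> (forall x, 0 <= f x)%E ->
  (\int[normal_prob 0 1]_x f x =
   \int[@lebesgue_measure R]_x (f x * (normal_pdf 0 1 x)%:E))%E.
Proof.
move=> mf f0; have dom := @normal_prob_dominates R 0 1.
rewrite -(Radon_Nikodym_SigmaFinite.change_of_variables dom f0 _ mf)//.
have iRN := Radon_Nikodym_SigmaFinite.f_integrable dom.
apply: ae_eq_integral => //.
- by apply: emeasurable_funM => //; exact: measurable_int iRN.
- apply: emeasurable_funM => //=; apply/measurableT_comp => //=.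
  exact: measurable_normal_pdf.
- apply: ae_eqe_mul2l => /=; apply: integral_ae_eq => //=.
  + by apply/measurableT_comp =>//; exact: measurable_normal_pdf.
  + by move=> E _ mE; rewrite -Radon_Nikodym_SigmaFinite.f_integral.
Qed.

(** Completing the square: the tilt times the standard density is the density of the normal law with
    mean [a]. *)
Lemma integral_normal_tilt (R : realType) (a : R) :
  (\int[normal_prob 0 1]_x (expR (x * a - a ^+ 2 / 2))%:E = 1)%E.
Proof.
have mE : measurable_fun [set: R] (fun x : R => (expR (x * a - a ^+ 2 / 2))).
  apply: measurableT_comp => //; apply: measurable_funB => //.
  exact: measurable_funM.
rewrite ge0_integral_normal_prob; last 2 first.
- exact/measurable_EFinP.
- by move=> x; rewrite lee_fin expR_ge0.
rewrite -(integral_normal_pdf a 1); apply: eq_integral => x _.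
rewrite -EFinM !normal_pdfE ?oner_neq0// /normal_fun mulrCA -expRD.
by congr (_ * expR _)%:E; field.
Qed.

(* Events that constrain only the coordinates other than a. *)
Definition cylinders_off (R : realType) (T : Type) (I : finType) (X : I -> T -> R)
    (a : I) : set (set T) :=
  [set D | exists B : I -> set R,
     [/\ forall i, measurable (B i), B a = setT &
         D = \bigcap_(i in [set i | i \in [set: I]%SET]) X i @^-1` B i]].

Section independent_gaussians.
Context {d : measure_display} {T : measurableType d} {R : realType}.
Context (P : probability T R) {I : finType} (X : I -> {RV P >-> R}).
Hypothesis X_normal : forall i (B : set R), measurable B ->
  distribution P (X i) B = normal_prob 0 1 B.
Hypothesis X_indep : mutually_independent P (fun i => X i : T -> R).

Lemma measurable_cylinder (J : {set I}) (B : I -> set R) :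
  (forall i, measurable (B i)) ->
  measurable (\bigcap_(i in [set i | i \in J]) X i @^-1` B i).
Proof.
move=> mB; apply: fin_bigcap_measurable; first exact: finite_finset.
by move=> i _; rewrite -[_ @^-1` _]setTI; apply: measurable_funP.
Qed.

Lemma cylinders_off_measurable a : cylinders_off X a `<=` measurable.
Proof. by move=> _ [B [mB _ ->]]; exact: measurable_cylinder. Qed.

Lemma cylinders_off_setT a : cylinders_off X a setT.
Proof.
exists (fun=> setT); split => //.
by rewrite eqEsubset; split => // x _ i.
Qed.

Lemma cylinders_off_setI a : setI_closed (cylinders_off X a).
Proof.
move=> _ _ [B [mB Ba ->]] [C [mC Ca ->]].
exists (fun i => B i `&` C i); split.
- by move=> i; exact: measurableI.
- by rewrite Ba Ca setIT.
- rewrite eqEsubset; split => x.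
    by move=> [h1 h2] i Ji; split; [exact: h1|exact: h2].
  by move=> h; split=> i Ji; case: (h i Ji).
Qed.

(** Since [B a = setT], the constraint [C] on [X a] can be stored at the entry [a], giving a
    cylinder again; the product formula then splits off its factor. *)
Lemma indep_cylinder a (C D : set _) : measurable C -> cylinders_off X a D ->
  P (D `&` X a @^-1` C) = (normal_prob 0 1 C * P D)%E.
Proof.
move=> mC [B [mB Ba ->]].
pose B' i := if i == a then C else B i.
have mB' i : measurable (B' i) by rewrite /B'; case: eqP.
have -> : \bigcap_(i in [set i | i \in [set: I]%SET]) X i @^-1` B i `&` X a @^-1` C =
          \bigcap_(i in [set i | i \in [set: I]%SET]) X i @^-1` B' i.
  rewrite eqEsubset; split => x.
    by move=> [h1 h2] i Ji; rewrite /B' /=; case: eqP => [->//|_]; exact: h1.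
  move=> h; split=> [i Ji|].
    by have /= := h i Ji; rewrite /B'; case: eqP => [->|//]; rewrite Ba.
  by have /= := h a (finset.in_setT _); rewrite /B' eqxx.
rewrite !X_indep// (bigD1 a) ?finset.in_setT// [in RHS](bigD1 a) ?finset.in_setT//=.
rewrite Ba preimage_setT probability_setT mul1r /B' eqxx -(X_normal a mC) /distribution /pushforward.
rewrite EFinM fineK ?fin_num_measure//; last first.
  by rewrite -[_ @^-1` _]setTI; apply: measurable_funP.
congr (_ * _%:E)%E; apply: eq_bigr => i /andP[_ /negPf ia].
by rewrite ia.
Qed.

(** Uniqueness of measures on a pi-system: as functions of [D] both sides are finite measures that
    agree on the cylinders. *)
Lemma indep_sigma_cylinder a (C D : set _) : measurable C ->
  <<s cylinders_off X a >> D ->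
  P (D `&` X a @^-1` C) = (normal_prob 0 1 C * P D)%E.
Proof.
move=> mC.
have mXC : measurable (X a @^-1` C).
  by rewrite -[_ @^-1` _]setTI; apply: measurable_funP.
have nC : normal_prob 0 1 C \is a fin_num by exact: fin_num_measure.
have nC0 : 0 <= fine (normal_prob 0 1 C) by rewrite fine_ge0.
pose m1 := mrestr P mXC; pose m2 := mscale (NngNum nC0) P.
have -> : (normal_prob 0 1 C * P D)%E = m2 D by rewrite /m2 /mscale/= fineK.
rewrite -[LHS]/(m1 D).
apply: (g_sigma_algebra_measure_unique (cylinders_off X a)
  (@cylinders_off_measurable a) (fun=> setT)).
- by move=> _; exact: cylinders_off_setT.
- by rewrite bigcup_const.
- exact: cylinders_off_setI.
- move=> A GA; rewrite -[LHS]/(P (A `&` X a @^-1` C)) -[RHS]/((fine (normal_prob 0 1 C))%:E * P A)%E.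
  by rewrite fineK//; exact: indep_cylinder.
- move=> k; rewrite -[X in (X < _)%E]/(P (setT `&` X a @^-1` C)) setTI.
  by rewrite (le_lt_trans (probability_le1 _ _))// ltry.
Qed.

(* T with the sigma-algebra generated by the X_i, i != a. *)
Definition off (a : I) := g_sigma_algebraType (cylinders_off X a).

Lemma measurable_to_off a : measurable_fun [set: T] (id : T -> off a).
Proof.
move=> _ B mB; rewrite setTI preimage_id.
have := smallest_sub (@sigma_algebra_measurable _ T) (@cylinders_off_measurable a).
exact.
Qed.

Lemma measurable_off_coord a i : i != a ->
  measurable_fun [set: off a] (X i : off a -> R).
Proof.
move=> ia _ B mB; rewrite setTI; apply: sub_sigma_algebra.
exists (fun j => if j == i then B else setT); split.
- by move=> j; case: eqP.
- by rewrite eq_sym (negPf ia).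
- rewrite eqEsubset; split=> x.
    by move=> Bx j _ /=; case: eqP => [->|].
  by move=> /(_ i (finset.in_setT _)) /=; rewrite eqxx.
Qed.

Let Rm := measurableTypeR R.

(** Given the coordinates other than [a], the variable [X a] is still standard Gaussian while [F]
    and [f] are fixed, so the tilt has conditional mean 1. Conditioning is expressed by a product
    measure on [Rm * off a] and Tonelli. *)
Lemma integral_tilt_independent a (F f : T -> R) :
  measurable_fun [set: off a] (F : off a -> R) ->
  measurable_fun [set: off a] (f : off a -> R) ->
  (forall w, 0 <= F w) ->
  (\int[P]_w (F w * expR (X a w * f w - f w ^+ 2 / 2))%:E = \int[P]_w (F w)%:E)%E.
Proof.
move=> mF mf F0.
pose i1 := isMeasurableFun.Build _ _ _ _ _ (@measurable_to_off a).
pose p1 : {mfun T >-> off a} := HB.pack (id : T -> off a) i1.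
have mphi : measurable_fun [set: T] (fun w => ((X a w : Rm), (w : off a))).
  apply: measurable_fun_pair; last exact: measurable_to_off.
  exact: (measurable_funP (X a)).
pose i2 := isMeasurableFun.Build _ _ _ _ _ mphi.
pose p2 : {mfun T >-> (Rm * off a)%type} := HB.pack (fun w => ((X a w : Rm), (w : off a))) i2.
pose m1 : probability Rm R := @normal_prob R 0 1.
pose m2 : probability (off a) R := distribution P p1.
(* The joint law of [X a] and of the point seen in [off a]: independence gives its value on
   rectangles, which determines it. *)
have prodE : forall S : set (Rm * off a), measurable S ->
    (m1 \x m2)%E S = distribution P p2 S.
  move=> S mS; have := (@product_measure_unique _ _ _ _ R m1 m2 (distribution P p2) _ S mS); apply => C D mC mD.
  rewrite -(indep_sigma_cylinder mC mD); congr (P _).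
  by rewrite eqEsubset; split=> x [].
pose h (z : Rm * off a) := (F z.2 * expR (z.1 * f z.2 - f z.2 ^+ 2 / 2))%:E.
have mh : measurable_fun [set: (Rm * off a)%type] h.
  apply/measurable_EFinP; apply: measurable_funM; first exact: measurableT_comp.
  apply: measurableT_comp => //; apply: measurable_funB.
    by apply: measurable_funM => //; exact: measurableT_comp.
  by apply: measurable_funM => //; apply: measurable_funX; exact: measurableT_comp.
have h0 z : (0 <= h z)%E by rewrite lee_fin mulr_ge0// expR_ge0.
transitivity (\int[distribution P p2]_z h z)%E.
  by rewrite ge0_integral_distribution.
rewrite (eq_measure_integral (m1 \x m2)%E); last first.
  by move=> S mS _; first [exact: prodE|exact/esym/prodE].
rewrite fubini_tonelli2//.
transitivity (\int[m2]_y (F y)%:E)%E; last first.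
  by rewrite ge0_integral_distribution//; exact/measurable_EFinP.
apply: eq_integral => y _; rewrite /fubini_G /h /=.
under eq_integral do rewrite EFinM.
rewrite ge0_integralZl//; first by rewrite integral_normal_tilt mule1.
  apply/measurable_EFinP; apply: measurableT_comp => //; apply: measurable_funB => //.
  exact: measurable_funM.
by rewrite lee_fin; exact: F0.
Qed.

(** No [f i] with [i] in [S] depends on a variable of [S], so these variables are integrated out one
    by one, each tilt contributing a factor 1. *)
Lemma integral_decoupled_tilt (S : {set I}) (f : I -> T -> R) :
  (forall a i, a \in S -> i \in S -> measurable_fun [set: off a] (f i : off a -> R)) ->
  (\int[P]_w (expR (\sum_(i in S) (X i w * f i w - f i w ^+ 2 / 2)))%:E = 1)%E.
Proof.
move=> mf.
suff: forall s : seq I, uniq s -> {subset s <= S} ->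
  (\int[P]_w (expR (\sum_(i <- s) (X i w * f i w - f i w ^+ 2 / 2)))%:E = 1)%E.
  move=> /(_ (enum S) (enum_uniq _)) <-; last by move=> i; rewrite mem_enum.
  by apply: eq_integral => w _; rewrite big_enum.
elim=> [_ _|a s IHs /= /andP[as_ us] sS].
  under eq_integral do rewrite big_nil expR0.
  by rewrite integral_cst//= probability_setT mule1.
have aS : a \in S by apply: sS; rewrite mem_head.
have sS' : {subset s <= S} by move=> i si; apply: sS; rewrite inE si orbT.
rewrite -[RHS](IHs us sS').
pose F w := expR (\sum_(i <- s) (X i w * f i w - f i w ^+ 2 / 2)).
rewrite -[RHS]/(\int[P]_w (F w)%:E)%E -(@integral_tilt_independent a F (f a)).
- by apply: eq_integral => w _; rewrite big_cons addrC expRD.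
- apply: measurableT_comp => //.
  (* The guard [i \in s] keeps membership available termwise; it yields [i != a]. *)
  have -> : (fun w => \sum_(i <- s) (X i w * f i w - f i w ^+ 2 / 2)) =
      (fun w => \sum_(i <- s) if i \in s then X i w * f i w - f i w ^+ 2 / 2 else 0).
    by apply/funext => w; rewrite big_seq big_mkcond.
  apply: (@measurable_sum _ (off a)) => i.
  case: (boolP (i \in s)) => [si|_]; last exact: measurable_cst.
  have iS := sS' _ si.
  apply: measurable_funB.
    apply: measurable_funM; last exact: mf.
    by apply: measurable_off_coord; apply: contraNneq as_ => <-.
  by apply: measurable_funM => //; apply: measurable_funX; exact: mf.
- exact: mf.
- by move=> w; exact: expR_ge0.
Qed.

Lemma measurable_decoupled_event (S : {set I}) (f : I -> T -> R) (t s : R) :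
  (forall i, measurable_fun [set: T] (f i)) ->
  measurable [set w | t <= \sum_(i in S) X i w * f i w /\
                      \sum_(i in S) f i w ^+ 2 <= s].
Proof.
move=> mf; rewrite [X in measurable X](_ : _ =
  [set w | t <= \sum_(i in S) X i w * f i w] `&`
  [set w | \sum_(i in S) f i w ^+ 2 <= s])//.
have msum (g : I -> T -> R) : (forall i, measurable_fun [set: T] (g i)) ->
    measurable_fun [set: T] (fun w => \sum_(i in S) g i w).
  move=> mg; have -> : (fun w => \sum_(i in S) g i w) =
      (fun w => \sum_i if i \in S then g i w else 0).
    by apply/funext => w; rewrite big_mkcond.
  by apply: measurable_sum => i; case: (boolP (i \in S)).
apply: measurableI; rewrite -[X in measurable X]setTI.
- apply: measurable_fun_le => //.
  by apply: msum => i; exact: measurable_funM.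
- apply: measurable_fun_le => //.
  by apply: msum => i; exact: measurable_funX.
Qed.

(* Chernoff bound with the normalized tilt exp (l X.f - l^2 |f|^2 / 2), of mean 1,
   so that |f|^2 need only be bounded on the event itself. *)
Lemma decoupled_tail (S : {set I}) (f : I -> T -> R) (t s : R) :
  (forall i, measurable_fun [set: T] (f i)) ->
  (forall a i, a \in S -> i \in S -> measurable_fun [set: off a] (f i : off a -> R)) ->
  0 < t -> 0 < s ->
  (P [set w | (t <= \sum_(i in S) X i w * f i w)%R /\
              ((\sum_(i in S) f i w ^+ 2) <= s)%R]
   <= (expR (- (t ^+ 2 / (2 * s))))%:E)%E.
Proof.
move=> mf moff t0 s0; set D := (X in P X).
have mD : measurable D by exact: measurable_decoupled_event.
(* This [l] maximizes [l * t - l ^+ 2 / 2 * s], with maximum [t ^+ 2 / (2 * s)]. *)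
pose l := t / s.
pose G w := expR (\sum_(i in S) (X i w * (l * f i w) - (l * f i w) ^+ 2 / 2)).
have intG : (\int[P]_w (G w)%:E = 1)%E.
  apply: integral_decoupled_tilt => a i aS iS.
  by apply: measurable_funM => //; exact: moff.
have mG : measurable_fun [set: T] G.
  apply: measurableT_comp => //.
  have -> : (fun w => \sum_(i in S) (X i w * (l * f i w) - (l * f i w) ^+ 2 / 2)) =
    (fun w => \sum_i if i \in S then (X i w * (l * f i w) - (l * f i w) ^+ 2 / 2) else 0).
    by apply/funext => w; rewrite big_mkcond.
  apply: measurable_sum => i; case: (boolP (i \in S)) => // _.
  apply: measurable_funB.
    by apply: measurable_funM => //; exact: measurable_funM.
  by apply: measurable_funM => //; apply: measurable_funX; exact: measurable_funM.
have GD w : D w -> expR (t ^+ 2 / (2 * s)) <= G w.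
  move=> [h1 h2]; rewrite ler_expR sumrB.
  have -> : \sum_(i in S) X i w * (l * f i w) = l * \sum_(i in S) X i w * f i w.
    by rewrite mulr_sumr; apply: eq_bigr => i _; ring.
  have -> : \sum_(i in S) (l * f i w) ^+ 2 / 2 = l ^+ 2 / 2 * \sum_(i in S) f i w ^+ 2.
    by rewrite mulr_sumr; apply: eq_bigr => i _; field.
  have l0 : 0 < l by exact: divr_gt0.
  have := ler_wpM2l (ltW l0) h1.
  have l20 : 0 <= l ^+ 2 / 2 by rewrite mulr_ge0 ?sqr_ge0.
  have := ler_wpM2l l20 h2.
  move=> k2 k1.
  have -> : t ^+ 2 / (2 * s) = l * t - l ^+ 2 / 2 * s.
    by rewrite /l; field; rewrite gt_eqF.
  lra.
(* Markov's inequality for [G], which has mean 1. *)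
have : (P D * (expR (t ^+ 2 / (2 * s)))%:E <= 1)%E.
  rewrite -intG muleC -(integral_cst P mD).
  apply: (@le_trans _ _ (\int[P]_(w in D) (G w)%:E)%E).
    apply: ge0_le_integral.
    - exact: mD.
    - by move=> w _; rewrite lee_fin expR_ge0.
    - exact: measurable_cst.
    - by apply: measurableT_comp => //; exact: measurable_funTS.
    - by move=> w Dw; rewrite lee_fin; exact: GD.
  apply: ge0_subset_integral => //; first exact/measurable_EFinP.
  by move=> w _; rewrite lee_fin expR_ge0.
rewrite expRN -lee_pdivlMr ?expR_gt0//.
by rewrite mul1e.
Qed.

(** The coefficient of [X i], for [i] in [S], is a linear form in the variables outside [S], hence
    measurable off every coordinate of [S]. *)
Lemma decoupled_chaos_tail (S : {set I}) (c : I -> I -> R) (t s : R) :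
  0 < t -> 0 < s ->
  (P [set w | (t <= \sum_(i in S) X i w * \sum_(j in ~: S) c i j * X j w)%R /\
              ((\sum_(i in S) (\sum_(j in ~: S) c i j * X j w) ^+ 2) <= s)%R]
   <= (expR (- (t ^+ 2 / (2 * s))))%:E)%E.
Proof.
move=> t0 s0.
have E i : (fun w => \sum_(j in (~: S)%SET) c i j * X j w) =
    (fun w => \sum_j if j \in (~: S)%SET then c i j * X j w else 0).
  by apply/funext => w; rewrite big_mkcond.
apply: (decoupled_tail (f := fun i w => \sum_(j in (~: S)%SET) c i j * X j w)) => //.
- move=> i; rewrite E; apply: measurable_sum => j.
  by case: (boolP (j \in _)) => // _; exact: measurable_funM.
- move=> a i aS iS; rewrite E; apply: (@measurable_sum _ (off a)) => j.
  case: (boolP (j \in _)) => [|_]; last exact: measurable_cst.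
  rewrite inE => jS; apply: measurable_funM; first exact: measurable_cst.
  by apply: measurable_off_coord; apply: contraNneq jS => ->.
Qed.

(** Constant coefficients are decoupled even when [S] contains all indices; the variance condition
    then holds everywhere and drops out of the event. *)
Lemma gaussian_tail (c : I -> R) (t s : R) : 0 < t -> 0 < s ->
  \sum_i c i ^+ 2 <= s ->
  (P [set w | (t <= \sum_i c i * X i w)%R] <= (expR (- (t ^+ 2 / (2 * s))))%:E)%E.
Proof.
move=> t0 s0 cs.
have := @decoupled_tail [set: I]%SET (fun i _ => c i) t s
  (fun i => measurable_cst _) (fun a i _ _ => measurable_cst _) t0 s0.
congr (P _ <= _)%E; rewrite eqEsubset; split => w /=.
  by move=> [h _]; rewrite (le_trans h)// le_eqVlt; apply/orP; left; apply/eqP;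
     apply: eq_big => [i|i _]; rewrite ?inE// mulrC.
move=> h; split; last by under eq_bigl do rewrite inE.
by rewrite (le_trans h)// le_eqVlt; apply/orP; left; apply/eqP;
     apply: eq_big => [i|i _]; rewrite ?inE// mulrC.
Qed.

End independent_gaussians.

(** * Finite nets for linear forms *)

Lemma sum_expr_half (R : realFieldType) (m : nat) :
  \sum_(i < m) (2^-1 : R) ^+ i = 2 - 2 * 2^-1 ^+ m.
Proof.
elim: m => [|m IHm]; first by rewrite big_ord0 expr0; ring.
by rewrite big_ord_recr /= IHm exprS; field.
Qed.

(** The distance from [i] to [K] by truncated subtraction: an index [i] of ['I_(K + K).+1] stands
    for the integer [i - K]. *)
Definition grid_abs (K i : nat) : nat := ((i - K) + (K - i))%N.

Lemma grid_abs_sqr (R : realFieldType) (K i : nat) :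
  ((i%:R - K%:R) ^+ 2 : R) = (grid_abs K i ^ 2)%:R.
Proof.
rewrite /grid_abs natrX; have [iK|Ki] := leqP i K.
  by rewrite (eqP iK) add0n natrB// -[LHS]sqrrN opprB.
have /eqP -> : (K - i == 0)%N by rewrite subn_eq0 ltnW.
by rewrite addn0 natrB// ltnW.
Qed.

(** [m <= m ^ 2] reduces the sum to a two-sided geometric series, whose total is 3. *)
Lemma sum_grid_weight (R : realFieldType) (K : nat) :
  \sum_(i < (K + K).+1) (2^-1 : R) ^+ (grid_abs K i ^ 2) <= 3.
Proof.
have le_half m : (2^-1 : R) ^+ (m ^ 2) <= 2^-1 ^+ m.
  apply: ler_wiXn2l; [by rewrite invr_ge0|by rewrite invf_le1 ?ler1n|].
  by case: m => // m; rewrite -[X in (X <= _)%N]expn1 leq_pexp2l.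
apply: (@le_trans _ _ (\sum_(i < (K + K).+1) (2^-1 : R) ^+ grid_abs K i)).
  by apply: ler_sum => i _; exact: le_half.
rewrite -(big_mkord xpredT (fun i => 2^-1 ^+ grid_abs K i)) -addnS big_mkord.
rewrite big_split_ord /=.
have -> : \sum_(i < K) (2^-1 : R) ^+ grid_abs K i = 2^-1 * \sum_(i < K) (2^-1) ^+ i.
  rewrite (reindex_inj rev_ord_inj) mulr_sumr; apply: eq_bigr => i _ /=.
  have iK := ltn_ord i.
  have -> : grid_abs K (K - i.+1) = i.+1 by rewrite /grid_abs; lia.
  by rewrite exprS.
have -> : \sum_(i < K.+1) (2^-1 : R) ^+ grid_abs K (K + i) = \sum_(i < K.+1) (2^-1) ^+ i.
  by apply: eq_bigr => i _; congr (_ ^+ _); rewrite /grid_abs; lia.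
rewrite !sum_expr_half.
have h m : 0 <= (2^-1 : R) ^+ m by rewrite exprn_ge0// invr_ge0.
by have := h K; have := h K.+1; lra.
Qed.

(* Weighting the point z by 16^N 2^(-|z|^2), which is at least 1 on the ball,
   makes the count factor over the coordinates; each factor is at most 48. *)
Lemma card_grid_ball (R : realFieldType) (D : finType) (K : nat) :
  #|[set z : {ffun D -> 'I_(K + K).+1} |
     (\sum_d grid_abs K (z d) ^ 2 <= 4 * #|D|)%N]%SET|%:R <= 48 ^+ #|D| :> R.
Proof.
rewrite -sum1_card natr_sum.
pose wt (i : 'I_(K + K).+1) : R := 16 * 2^-1 ^+ (grid_abs K i ^ 2).
have wt0 i : 0 <= wt i by rewrite mulr_ge0// exprn_ge0// invr_ge0.
apply: (@le_trans _ _ (\sum_(z : {ffun D -> 'I_(K + K).+1}) \prod_d wt (z d))).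
  rewrite big_mkcond/=; apply: ler_sum => z _; rewrite inE.
  have e16 : 2 ^+ 4 = 16 :> R by ring.
  have prod0 : 0 <= \prod_d wt (z d) by exact: prodr_ge0.
  case: ifP => // zle.
  rewrite big_split /= prodr_const prodrXr -e16 -exprM.
  have e1 : (2 ^+ (4 * #|D|) * 2^-1 ^+ (4 * #|D|) : R) = 1.
    by rewrite exprVn divff// expf_neq0.
  rewrite -[leLHS]e1; apply: ler_wpM2l; first by rewrite exprn_ge0.
  by apply: ler_wiXn2l; rewrite ?invr_ge0// invf_le1 ?ler1n.
rewrite -(bigA_distr_bigA (fun _ i => wt i)) /= prodr_const.
apply: lerXn2r; rewrite ?nnegrE ?sumr_ge0//.
rewrite -mulr_sumr; apply: (@le_trans _ _ (16 * 3)); last by rewrite -natrM ler_nat.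
by apply: ler_wpM2l => //; exact: sum_grid_weight.
Qed.

(** Rounding up or down by the sign of [c] moves [y] by at most 1, and
    [k ^ 2 <= 2 y ^ 2 + 2 (k - y) ^ 2]. *)
Lemma round_toward (R : realType) (c y : R) :
  exists k : int, c * y <= c * k%:~R /\ (k%:~R : R) ^+ 2 <= 2 * y ^+ 2 + 2.
Proof.
have fle := floor_le y; have ltf := floorD1_gt y; rewrite intrD in ltf.
have sq (k : int) : -1 <= k%:~R - y <= 1 -> (k%:~R : R) ^+ 2 <= 2 * y ^+ 2 + 2.
  move=> /andP[h1 h2].
  have p1 : 0 <= (1 - (k%:~R - y)) * (1 + (k%:~R - y)) by apply: mulr_ge0; lra.
  have p2 := sqr_ge0 (2 * y - k%:~R); rewrite -subr_ge0.
  rewrite [leRHS](_ : _ = (2 * y - k%:~R) ^+ 2 + 2 * ((1 - (k%:~R - y)) * (1 + (k%:~R - y)))); last by ring.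
  by rewrite addr_ge0// mulr_ge0.
have [c0|c0] := leP 0 c.
  exists (Num.floor y + 1); split.
    by apply: ler_wpM2l => //; rewrite intrD ltW.
  by apply: sq; rewrite intrD; apply/andP; split; lra.
exists (Num.floor y); split; first by rewrite ler_wnM2l// ltW.
by apply: sq; apply/andP; split; lra.
Qed.

(** Not a metric net: only upper bounds of linear forms are transferred, but without discretization
    loss. The point [z] may depend on [c] and may leave the unit ball. *)
Definition linear_net (R : realFieldType) (D : finType) (s : seq {ffun D -> R}) :=
  forall c u : D -> R, \sum_d u d ^+ 2 <= 1 ->
    exists2 z : {ffun D -> R}, z \in s & \sum_d c d * u d <= \sum_d c d * z d.

(* The net is the set of points of the grid N^(-1/2) Z^N (N = #|D|) of norm at
   most 2.  Each coordinate of u is rounded up or down according to the sign of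
   the coefficient of c, so a linear form on the unit ball is dominated exactly
   by its values on the net, and multilinear forms one argument at a time. *)
Lemma finite_linear_net (R : realType) (D : finType) :
  exists s : seq {ffun D -> R},
  [/\ (size s <= 48 ^ #|D|)%N,
      forall z, z \in s -> \sum_d z d ^+ 2 <= 4 &
      linear_net s].
Proof.
(* [K] only has to dominate every coordinate of an integer point of squared norm at most [4 * N], so
   that rounded points fit in the index range. *)
pose N := #|D|; pose K := (2 * N + 2)%N.
pose good := [set z : {ffun D -> 'I_(K + K).+1} |
     (\sum_d grid_abs K (z d) ^ 2 <= 4 * N)%N]%SET.
pose sc (z : {ffun D -> 'I_(K + K).+1}) : {ffun D -> R} :=
  [ffun d => (((z d : nat)%:R - K%:R) / Num.sqrt N%:R)].
have N0 (d : D) : 0 < N%:R :> R by rewrite ltr0n; apply/card_gt0P; exists d.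
exists [seq sc z | z <- enum good]; split.
- by rewrite size_map -cardE -(ler_nat R) natrX; exact: card_grid_ball.
- move=> _ /mapP[z + ->]; rewrite mem_enum inE => zle.
  have [D0|[d0 _]] := set_0Vmem [set: D]%SET.
    by rewrite big1// => d; have := finset.in_set0 d; rewrite -D0 finset.in_setT.
  have -> : \sum_d sc z d ^+ 2 = (\sum_d grid_abs K (z d) ^ 2)%N%:R / N%:R.
    rewrite natr_sum mulr_suml; apply: eq_bigr => d _.
    by rewrite ffunE expr_div_n grid_abs_sqr sqr_sqrtr ?ler0n.
  by rewrite ler_pdivrMr ?N0// -natrM ler_nat.
- move=> c u u1.
  pose y d := Num.sqrt N%:R * u d.
  have [k kP] := boolp.choice (fun d => round_toward (c d) (y d)).
  (* The squared norm of [y] is at most [N], and rounding costs [2 y ^ 2 + 2] per coordinate: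
     [2 N + 2 N] in total. *)
  have ksum : \sum_d (k d)%:~R ^+ 2 <= 4 * N%:R :> R.
    apply: (@le_trans _ _ (\sum_d (2 * y d ^+ 2 + 2))).
      by apply: ler_sum => d _; case: (kP d).
    rewrite big_split /= sumr_const -/N -mulr_sumr.
    have -> : \sum_d y d ^+ 2 = N%:R * \sum_d u d ^+ 2.
      by rewrite mulr_sumr; apply: eq_bigr => d _; rewrite exprMn sqr_sqrtr.
    rewrite -[2 *+ _]mulr_natr.
    rewrite -[leRHS](_ : 2 * (N%:R * 1) + 2 * N%:R = _); last by ring.
    by apply: lerD => //; do 2!apply: ler_wpM2l => //.
  have ksumn : (\sum_d `|k d| ^ 2 <= 4 * N)%N.
    rewrite -(ler_nat R) natr_sum natrM (le_trans _ ksum)//.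
    apply: ler_sum => d _; rewrite natrX -[X in _ <= X]real_normK ?num_real//.
    by rewrite -intr_norm -natr_absz.
  have kK d : (`|k d| <= K)%N.
    have : (`|k d| ^ 2 <= 4 * N)%N.
      by apply: leq_trans ksumn; rewrite (bigD1 d)//= leq_addr.
    rewrite /K; nia.
  pose z : {ffun D -> 'I_(K + K).+1} := [ffun d => inord (absz (k d + K%:Z))].
  have zE d : (z d : nat) = absz (k d + K%:Z).
    by rewrite ffunE inordK//; have := kK d; lia.
  have zR d : (z d : nat)%:R - K%:R = (k d)%:~R :> R.
    rewrite zE natr_absz ger0_norm; last by have := kK d; lia.
    by rewrite intrD addrK.
  have gz d : grid_abs K (z d) = `|k d|%N.
    by rewrite /grid_abs zE; have := kK d; lia.
  exists (sc z).
    apply/mapP; exists z => //; rewrite mem_enum inE.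
    by rewrite (eq_bigr (fun d => `|k d| ^ 2)%N)// => d _; rewrite gz.
  apply: ler_sum => d _; rewrite ffunE zR mulrA ler_pdivlMr ?sqrtr_gt0 ?N0//.
  have [h _] := kP d; apply: le_trans h.
  by rewrite /y le_eqVlt; apply/orP; left; apply/eqP; ring.
Qed.

(** * Positive semidefinite kernels *)

Definition psd_kernel (R : realFieldType) (D : finType) (Y : D -> D -> R) :=
  (forall a b, Y a b = Y b a) /\
  (forall c : D -> R, 0 <= \sum_a \sum_b c a * c b * Y a b).

Lemma sum_delta (R : realFieldType) (D : finType) (d : D) (F : D -> R) :
  \sum_a (a == d)%:R * F a = F d.
Proof.
rewrite (bigD1 d)//= eqxx mul1r big1 ?addr0// => a /negPf ->.
by rewrite mul0r.
Qed.

(** The quadratic form at [c + t e_d], expanded in [t]. *)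
Lemma psd_kernel_shift (R : realFieldType) (D : finType) (Y : D -> D -> R)
    (c : D -> R) (t : R) (d : D) : psd_kernel Y ->
  0 <= \sum_a \sum_b c a * c b * Y a b + 2 * t * \sum_a c a * Y a d + t ^+ 2 * Y d d.
Proof.
move=> [sY pY]; have := pY (fun a => c a + t * (a == d)%:R); congr (0 <= _).
transitivity (\sum_a (\sum_b c a * c b * Y a b + t * (c a * Y a d) +
    (a == d)%:R * (t * (\sum_b c b * Y d b) + t ^+ 2 * Y d d))).
  apply: eq_bigr => a _.
  rewrite -(sum_delta d (fun b => t * (c a * Y a b))).
  rewrite -(sum_delta d (fun b => t ^+ 2 * Y d b)).
  rewrite mulrDr !mulr_sumr -!big_split /=; apply: eq_bigr => b _.
  by case: (eqVneq a d) => [->|_] /=; ring.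
rewrite !big_split /= sum_delta -mulr_sumr.
have -> : \sum_b c b * Y d b = \sum_a c a * Y a d by apply: eq_bigr => b _; rewrite sY.
by ring.
Qed.

(** Cholesky elimination, by induction on a list [s] outside which the rows of the kernel vanish. A
    zero diagonal entry forces a zero row; a positive one allows a rank-one term to be split off. *)
Lemma psd_kernel_gram (R : rcfType) (D : finType) (Y : D -> D -> R) :
  psd_kernel Y ->
  exists l : seq (D -> R), forall a b, Y a b = \sum_(y <- l) y a * y b.
Proof.
move=> psdY.
suff: forall s : seq D, (forall a b, a \notin s -> Y a b = 0) ->
    exists l : seq (D -> R), forall a b, Y a b = \sum_(y <- l) y a * y b.
  by move=> /(_ (enum D)); apply => a b; rewrite mem_enum.
move=> s; elim: s Y psdY => [|d s IHs] Y psdY Y0.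
  by exists [::] => a b; rewrite big_nil Y0.
have [sY pY] := psdY.
have Ydd : 0 <= Y d d.
  have := psd_kernel_shift (fun=> 0) 1 d psdY.
  rewrite big1; last by move=> a _; rewrite big1// => b _; rewrite !mul0r.
  rewrite big1; last by move=> a _; rewrite mul0r.
  by rewrite expr1n mulr0 !add0r mul1r.
have [Yd0|Yd0] := eqVneq (Y d d) 0.
  apply: IHs => // a b ans; have [->|ad] := eqVneq a d; last first.
    by apply: Y0; rewrite inE (negPf ad).
  apply/eqP/negPn/negP => Ydb.
  (* With [Y d d = 0] the form at [e_b + t e_d] is affine in [t]; this [t] gives it the value -1. *)
  have := psd_kernel_shift (fun x => (x == b)%:R) (- ((Y b b + 1) / (2 * Y d b))) d psdY.
  rewrite sum_delta [Y b d]sY.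
  have -> : \sum_x \sum_y (x == b)%:R * (y == b)%:R * Y x y = Y b b.
    rewrite -[RHS](sum_delta b (fun x => Y x b)); apply: eq_bigr => x _.
    rewrite -(sum_delta b (fun y => Y x y)) mulr_sumr.
    by apply: eq_bigr => y _; rewrite mulrA.
  rewrite Yd0 mulr0 addr0.
  have -> : Y b b + 2 * - ((Y b b + 1) / (2 * Y d b)) * Y d b = -1 by field.
  by rewrite oppr_ge0 ler10.
have Yp : 0 < Y d d by rewrite lt_def Yd0.
(* The Schur complement of the entry [d], whose row [d] vanishes. *)
pose Y' a b := Y a b - Y a d * Y b d / Y d d.
have psdY' : psd_kernel Y'.
  split=> [a b|c]; first by rewrite /Y' sY [_ * Y b d]mulrC.
  (* At the minimizing shift the form of [Y] equals the form of [Y'] at [c]. *)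
  have := psd_kernel_shift c (- ((\sum_a c a * Y a d) / Y d d)) d psdY.
  congr (0 <= _); set L := \sum_a c a * Y a d.
  have -> : \sum_a \sum_b c a * c b * Y' a b =
      \sum_a \sum_b c a * c b * Y a b - L ^+ 2 / Y d d.
    rewrite expr2 {1}/L !mulr_suml -sumrB; apply: eq_bigr => a _.
    rewrite /L mulr_sumr mulr_suml -sumrB.
    by apply: eq_bigr => b _; rewrite /Y'; field.
  by field.
have [a b ans|l lE] := IHs Y' psdY'.
  rewrite /Y'; have [->|ad] := eqVneq a d; first by rewrite [Y b d]sY; field.
  have Ya x : Y a x = 0 by apply: Y0; rewrite inE (negPf ad).
  by rewrite !Ya !mul0r subrr.
exists ((fun a => Y a d / Num.sqrt (Y d d)) :: l) => a b.
rewrite big_cons -lE /Y' mulrACA -invfM -expr2 sqr_sqrtr//.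
by rewrite addrC subrK.
Qed.

(** * Trilinear, cut and quartic forms of a tensor *)

Definition trilinear (R : realFieldType) (n : nat) (A : tensor3 R n)
    (x y z : 'I_n -> R) : R :=
  \sum_i \sum_j \sum_k A i j k * x i * y j * z k.

(* The part of sum_i A_i (x) A_i with row indices j in J and j' outside J: its two
   factors involve disjoint sets of entries of A. *)
Definition cut_form (R : realFieldType) (n : nat) (A : tensor3 R n)
    (J : {set 'I_n}) (u v : 'I_n * 'I_n -> R) : R :=
  \sum_(j in J) \sum_(j' in ~: J) \sum_i \sum_k \sum_k'
    A i j k * A i j' k' * u (j, j') * v (k, k').

(** When [m j k j' k'] is the moment [E x_j x_k x_j' x_k'], this is [E sum_i q_i ^ 2] for the slices
    [q_i] of the cubic. *)
Definition quartic_form (R : realFieldType) (n : nat) (A : tensor3 R n)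
    (m : 'I_n -> 'I_n -> 'I_n -> 'I_n -> R) : R :=
  \sum_j \sum_j' \sum_i \sum_k \sum_k' A i j k * A i j' k' * m j k j' k'.

Section deterministic.
Context {R : realType} {n : nat}.
Implicit Types (A : tensor3 R n) (x y z : 'I_n -> R) (J : {set 'I_n}).

Lemma trilinear1 A x y z :
  trilinear A x y z = \sum_i (\sum_j \sum_k A i j k * y j * z k) * x i.
Proof.
apply: eq_bigr => i _; rewrite mulr_suml; apply: eq_bigr => j _.
by rewrite mulr_suml; apply: eq_bigr => k _; ring.
Qed.

Lemma trilinear2 A x y z :
  trilinear A x y z = \sum_j (\sum_i \sum_k A i j k * x i * z k) * y j.
Proof.
rewrite /trilinear exchange_big /=; apply: eq_bigr => j _.
rewrite mulr_suml; apply: eq_bigr => i _; rewrite mulr_suml.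
by apply: eq_bigr => k _; ring.
Qed.

Lemma trilinear3 A x y z :
  trilinear A x y z = \sum_k (\sum_i \sum_j A i j k * x i * y j) * z k.
Proof.
rewrite /trilinear; under eq_bigr do rewrite exchange_big /=.
rewrite exchange_big /=; apply: eq_bigr => k _.
rewrite mulr_suml; apply: eq_bigr => i _; rewrite mulr_suml.
by apply: eq_bigr => j _.
Qed.

Lemma trilinear_net A (s : seq {ffun 'I_n -> R}) (K : R) : linear_net s ->
  (forall x y z : {ffun 'I_n -> R}, x \in s -> y \in s -> z \in s -> trilinear A x y z <= K) ->
  forall x y z, \sum_i x i ^+ 2 <= 1 -> \sum_i y i ^+ 2 <= 1 ->
    \sum_i z i ^+ 2 <= 1 -> trilinear A x y z <= K.
Proof.
move=> net bnd x y z x1 y1 z1.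
rewrite trilinear1.
have [x' sx' hx] := net (fun i => \sum_j \sum_k A i j k * y j * z k) x x1.
apply: le_trans hx _; rewrite -trilinear1 trilinear2.
have [y' sy' hy] := net (fun j => \sum_i \sum_k A i j k * x' i * z k) y y1.
apply: le_trans hy _; rewrite -trilinear2 trilinear3.
have [z' sz' hz] := net (fun k => \sum_i \sum_j A i j k * x' i * y' j) z z1.
by apply: le_trans hz _; rewrite -trilinear3 bnd.
Qed.

(** A linear form in [u] over all pairs, the shape on which [linear_net] acts; the restrictions to
    [J] and its complement become coefficients 0 or 1. *)
Lemma cut_form1 A J u v : cut_form A J u v =
  \sum_(p : 'I_n * 'I_n) ((p.1 \in J)%:R * (p.2 \in ~: J)%:R *
    \sum_i \sum_k \sum_k' A i p.1 k * A i p.2 k' * v (k, k')) * u p.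
Proof.
pose F j j' := (j \in J)%:R * (j' \in ~: J)%:R *
    (\sum_i \sum_k \sum_k' A i j k * A i j' k' * v (k, k')) * u (j, j').
rewrite [RHS](eq_bigr (fun p => F p.1 p.2)); last by case.
rewrite -(pair_bigA _ F) /cut_form /F /=.
rewrite big_mkcond /=; apply: eq_bigr => j _.
case: (j \in J); last by rewrite big1// => j' _; rewrite !mul0r.
rewrite big_mkcond /=; apply: eq_bigr => j' _; case: (j' \in ~: J); last by rewrite mulr0 !mul0r.
rewrite !mul1r mulr_suml; apply: eq_bigr => i _.
rewrite mulr_suml; apply: eq_bigr => k _.
by rewrite mulr_suml; apply: eq_bigr => k' _; ring.
Qed.

Lemma cut_form2 A J u v : cut_form A J u v =
  \sum_(p : 'I_n * 'I_n) (\sum_(j in J) \sum_(j' in ~: J) \sum_i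
    A i j p.1 * A i j' p.2 * u (j, j')) * v p.
Proof.
pose F k k' := (\sum_(j in J) \sum_(j' in ~: J) \sum_i
    A i j k * A i j' k' * u (j, j')) * v (k, k').
rewrite [RHS](eq_bigr (fun p => F p.1 p.2)); last by case.
rewrite -(pair_bigA _ F) /F /=.
under [RHS]eq_bigr do under eq_bigr do rewrite mulr_suml.
under [RHS]eq_bigr do rewrite exchange_big /=.
rewrite [RHS]exchange_big /=; apply: eq_bigr => j _.
under [RHS]eq_bigr do under eq_bigr do rewrite mulr_suml.
under [RHS]eq_bigr do rewrite exchange_big /=.
rewrite [RHS]exchange_big /=; apply: eq_bigr => j' _.
under [RHS]eq_bigr do under eq_bigr do rewrite mulr_suml.
under [RHS]eq_bigr do rewrite exchange_big /=.
by rewrite [RHS]exchange_big.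
Qed.

Lemma cut_form_net A J (s : seq {ffun 'I_n * 'I_n -> R}) (K : R) : linear_net s ->
  (forall u v : {ffun 'I_n * 'I_n -> R}, u \in s -> v \in s -> cut_form A J u v <= K) ->
  forall u v : 'I_n * 'I_n -> R,
    \sum_p u p ^+ 2 <= 1 -> \sum_p v p ^+ 2 <= 1 -> cut_form A J u v <= K.
Proof.
move=> net bnd u v u1 v1.
rewrite cut_form1.
have [u' su' hu] := net (fun p => (p.1 \in J)%:R * (p.2 \in ~: J)%:R *
    \sum_i \sum_k \sum_k' A i p.1 k * A i p.2 k' * v (k, k')) u u1.
apply: le_trans hu _; rewrite -cut_form1 cut_form2.
have [v' sv' hv] := net (fun p => \sum_(j in J) \sum_(j' in ~: J) \sum_i
    A i j p.1 * A i j' p.2 * u' (j, j')) v v1.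
by apply: le_trans hv _; rewrite -cut_form2 bnd.
Qed.

Lemma cut_formZ A J (a : R) (y : 'I_n * 'I_n -> R) :
  cut_form A J (fun p => a * y p) (fun p => a * y p) = a ^+ 2 * cut_form A J y y.
Proof.
rewrite /cut_form mulr_sumr; apply: eq_bigr => j _.
rewrite mulr_sumr; apply: eq_bigr => j' _; rewrite mulr_sumr; apply: eq_bigr => i _.
rewrite mulr_sumr; apply: eq_bigr => k _; rewrite mulr_sumr; apply: eq_bigr => k' _.
by ring.
Qed.

Lemma sum_sqr_scale (D : finType) (a : R) (y : D -> R) :
  \sum_p (a * y p) ^+ 2 = a ^+ 2 * \sum_p y p ^+ 2.
Proof. by rewrite mulr_sumr; apply: eq_bigr => p _; rewrite exprMn. Qed.

Lemma sum_sqr_eq0 (D : finType) (y : D -> R) :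
  \sum_p y p ^+ 2 = 0 -> forall p, y p = 0.
Proof.
move=> /eqP; rewrite psumr_eq0; last by move=> p _; exact: sqr_ge0.
by move=> /allP h p; apply/eqP; rewrite -sqrf_eq0; apply: h; rewrite mem_index_enum.
Qed.

(** Both sides are quadratic in [y], so [y] can be scaled to norm 1; [y = 0] is treated apart. *)
Lemma cut_form_diag_le A J (K : R) :
  (forall u v : 'I_n * 'I_n -> R,
    \sum_p u p ^+ 2 <= 1 -> \sum_p v p ^+ 2 <= 1 -> cut_form A J u v <= K) ->
  forall y : 'I_n * 'I_n -> R, cut_form A J y y <= K * \sum_p y p ^+ 2.
Proof.
move=> bnd y; set S := \sum_p y p ^+ 2.
have S0 : 0 <= S by apply: sumr_ge0 => p _; exact: sqr_ge0.
have [Sz|Snz] := eqVneq S 0.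
  rewrite Sz mulr0 /cut_form big1// => j _; rewrite big1// => j' _.
  rewrite big1// => i _; rewrite big1// => k _; rewrite big1// => k' _.
  by rewrite (sum_sqr_eq0 Sz (j, j')) mulr0 mul0r.
have Sp : 0 < S by rewrite lt_def Snz.
have sq : (Num.sqrt S)^-1 ^+ 2 = S^-1 by rewrite exprVn sqr_sqrtr.
have := bnd (fun p => (Num.sqrt S)^-1 * y p) (fun p => (Num.sqrt S)^-1 * y p).
rewrite cut_formZ !sum_sqr_scale -/S sq mulVf// lexx => /(_ isT isT).
by rewrite mulrC ler_pdivrMr.
Qed.

(** Duality: the norm of the vector [q] is its pairing with [q / |q|], which is a value of the
    trilinear form at unit vectors once [y] and [z] are normalized. *)
Lemma trilinear_sqr_le A (K : R) : 0 <= K ->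
  (forall x y z, \sum_i x i ^+ 2 <= 1 -> \sum_i y i ^+ 2 <= 1 ->
    \sum_i z i ^+ 2 <= 1 -> trilinear A x y z <= K) ->
  forall y z, \sum_i (\sum_j \sum_k A i j k * y j * z k) ^+ 2 <=
     K ^+ 2 * (\sum_i y i ^+ 2) * (\sum_i z i ^+ 2).
Proof.
move=> K0 bnd y z; set q := fun i => \sum_j \sum_k A i j k * y j * z k.
have -> : \sum_i (\sum_j \sum_k A i j k * y j * z k) ^+ 2 = \sum_i q i ^+ 2 by [].
set S := \sum_i q i ^+ 2; set a := \sum_i y i ^+ 2; set b := \sum_i z i ^+ 2.
have nn (D : finType) (w : D -> R) : 0 <= \sum_p w p ^+ 2.
  by apply: sumr_ge0 => p _; exact: sqr_ge0.
have [Sz|Snz] := eqVneq S 0; first by rewrite Sz !mulr_ge0 ?sqr_ge0 ?nn.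
have Sp : 0 < S by rewrite lt_def Snz nn.
have ap : 0 < a.
  rewrite lt_def nn andbT; apply: contra_neq Snz => az; rewrite /S big1// => i _.
  rewrite /q big1 ?expr0n// => j _; rewrite big1// => k _.
  by rewrite (sum_sqr_eq0 az j) mulr0 mul0r.
have bp : 0 < b.
  rewrite lt_def nn andbT; apply: contra_neq Snz => bz; rewrite /S big1// => i _.
  rewrite /q big1 ?expr0n// => j _; rewrite big1// => k _.
  by rewrite (sum_sqr_eq0 bz k) mulr0.
have sq (w : R) : 0 < w -> (Num.sqrt w)^-1 ^+ 2 = w^-1.
  by move=> w0; rewrite exprVn sqr_sqrtr// ltW.
have := bnd (fun i => (Num.sqrt S)^-1 * q i) (fun i => (Num.sqrt a)^-1 * y i)
  (fun i => (Num.sqrt b)^-1 * z i).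
rewrite !sum_sqr_scale !sq// -/S -/a -/b !mulVf ?gt_eqF// lexx => /(_ isT isT isT).
have -> : trilinear A (fun i => (Num.sqrt S)^-1 * q i) (fun i => (Num.sqrt a)^-1 * y i)
  (fun i => (Num.sqrt b)^-1 * z i) =
  (Num.sqrt S)^-1 * (Num.sqrt a)^-1 * (Num.sqrt b)^-1 * S.
  rewrite trilinear1 /S mulr_sumr; apply: eq_bigr => i _.
  have -> : \sum_j \sum_k A i j k * ((Num.sqrt a)^-1 * y j) * ((Num.sqrt b)^-1 * z k)
     = (Num.sqrt a)^-1 * (Num.sqrt b)^-1 * q i.
    rewrite /q mulr_sumr; apply: eq_bigr => j _; rewrite mulr_sumr.
    by apply: eq_bigr => k _; ring.
  by ring.
move=> h.
have sS : 0 < Num.sqrt S by rewrite sqrtr_gt0.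
have sa : 0 < Num.sqrt a by rewrite sqrtr_gt0.
have sb : 0 < Num.sqrt b by rewrite sqrtr_gt0.
have h2 : Num.sqrt S <= K * Num.sqrt a * Num.sqrt b.
  rewrite -ler_pdivrMr// -ler_pdivrMr//; apply: le_trans h.
  rewrite [X in _ <= _ * X](_ : S = Num.sqrt S ^+ 2); last by rewrite sqr_sqrtr// ltW.
  rewrite le_eqVlt; apply/orP; left; apply/eqP.
  by field; rewrite !gt_eqF.
have : Num.sqrt S ^+ 2 <= (K * Num.sqrt a * Num.sqrt b) ^+ 2.
  by apply: lerXn2r => //; rewrite nnegrE ?mulr_ge0// ltW.
by rewrite !exprMn !sqr_sqrtr ?(ltW ap) ?(ltW bp) ?(ltW Sp).
Qed.

(** Deleting [j] identifies these [J] with the subsets of the complement of the pair, of which there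
    are [2 ^ (n - 2)]. *)
Lemma card_cut (j j' : 'I_n) : j != j' ->
  (4 * #|[set J : {set 'I_n} | (j \in J) && (j' \in ~: J)]%SET| = 2 ^ n)%N.
Proof.
move=> jj'.
have -> : [set J : {set 'I_n} | (j \in J) && (j' \in ~: J)]%SET =
  [set (j |: J) | J in powerset (~: [set j; j'])]%SET.
  apply/setP => J; rewrite inE; apply/andP/imsetP => [[jJ]|[J']].
    rewrite inE => j'J; exists (J :\ j)%SET; last by rewrite finset.setD1K.
    rewrite powersetE; apply/fintype.subsetP => i; rewrite !inE negb_or => /andP[-> iJ] /=.
    by apply: contraNneq j'J => <-.
  rewrite powersetE => /fintype.subsetP sub ->; rewrite !inE eqxx /= eq_sym (negPf jj') /=.
  by split => //; apply/negP => /sub; rewrite !inE eqxx orbT.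
rewrite card_in_imset; last first.
  move=> J1 J2; rewrite !powersetE => /fintype.subsetP s1 /fintype.subsetP s2 e.
  have jn (J : {set 'I_n}) : {subset J <= (~: [set j; j'])%SET} -> j \notin J.
    by move=> s; apply/negP => /s; rewrite !inE eqxx.
  by rewrite -(finset.setU1K (jn _ s1)) e finset.setU1K ?jn.
rewrite card_powerset cardsCs finset.setCK card_ord cards2 jj' -(expnD 2 2) subnKC//.
by rewrite -[n]card_ord; apply: leq_trans (max_card [set j; j']%SET); rewrite cards2 jj'.
Qed.

(* A uniformly random J cuts an ordered pair j != j' with probability 1/4. *)
Lemma offdiag_le_cuts (H : 'I_n -> 'I_n -> R) (B : R) :
  (forall J, \sum_(j in J) \sum_(j' in ~: J) H j j' <= B) ->
  \sum_j \sum_(j' | j' != j) H j j' <= 4 * B.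
Proof.
move=> bnd.
have key : \sum_(J : {set 'I_n}) \sum_(j in J) \sum_(j' in ~: J) H j j' =
    \sum_j \sum_(j' | j' != j) (2 ^+ n / 4) * H j j'.
  under eq_bigr do rewrite big_mkcond /=.
  rewrite exchange_big /=; apply: eq_bigr => j _.
  have -> : \sum_(J : {set 'I_n}) (if j \in J then \sum_(j' in ~: J) H j j' else 0) =
      \sum_(J : {set 'I_n}) \sum_j' (if (j \in J) && (j' \in ~: J) then H j j' else 0).
    apply: eq_bigr => J _; case: (j \in J); first by rewrite big_mkcond.
    by rewrite big1.
  rewrite exchange_big /= [RHS]big_mkcond /=; apply: eq_bigr => j' _.
  have [->|jj'] := eqVneq j' j.
    by rewrite big1// => J _; rewrite !inE; case: (j \in J).
  rewrite -big_mkcond /= sumr_const.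
  rewrite -[LHS]mulr_natl; congr (_ * _).
  have := card_cut (_ : j != j'); rewrite eq_sym => /(_ jj') e.
  rewrite -natrX -e natrM mulrAC divff// mul1r; congr (_%:R).
  by apply: eq_card => J; rewrite inE.
have : \sum_(J : {set 'I_n}) \sum_(j in J) \sum_(j' in ~: J) H j j' <= 2 ^+ n * B.
  apply: (@le_trans _ _ (\sum_(J : {set 'I_n}) B)); first exact: ler_sum.
  rewrite sumr_const -cardsT -powersetT card_powerset cardsT card_ord.
  by rewrite -[_ *+ _]mulr_natl natrX.
rewrite key; under eq_bigr do rewrite -mulr_sumr.
rewrite -mulr_sumr -mulrA ler_pM2l ?exprn_gt0//.
by rewrite ler_pdivrMl.
Qed.

(** For [j = j'] the kernel in [k], [k'] is a sum of rank-one terms, each bounded by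
    [trilinear_sqr_le] at a basis vector. For [j != j'] the moments are regrouped as a kernel
    between the pairs [(j, j')] and [(k, k')], whose rank-one terms are cut forms on the diagonal.
    By the symmetry of [m] both kernels have total trace 1. *)
Lemma quartic_form_le A (m : 'I_n -> 'I_n -> 'I_n -> 'I_n -> R) (K B : R) : 0 <= K ->
  (forall x y z, \sum_i x i ^+ 2 <= 1 -> \sum_i y i ^+ 2 <= 1 ->
    \sum_i z i ^+ 2 <= 1 -> trilinear A x y z <= K) ->
  (forall J (u v : 'I_n * 'I_n -> R),
    \sum_p u p ^+ 2 <= 1 -> \sum_p v p ^+ 2 <= 1 -> cut_form A J u v <= B) ->
  psd_kernel (fun p q : 'I_n * 'I_n => m p.1 q.1 p.2 q.2) ->
  (forall j, psd_kernel (fun k k' => m j k j k')) ->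
  (forall j k, m j k j k = m j j k k) ->
  \sum_j \sum_k m j k j k = 1 ->
  quartic_form A m <= K ^+ 2 + 4 * B.
Proof.
move=> K0 tri cut psd2 psd1 msym tr1.
pose H j j' := \sum_i \sum_k \sum_k' A i j k * A i j' k' * m j k j' k'.
have -> : quartic_form A m = \sum_j H j j + \sum_j \sum_(j' | j' != j) H j j'.
  by rewrite -big_split /=; apply: eq_bigr => j _; rewrite (bigD1 j).
apply: lerD.
  rewrite -[leRHS]mulr1 -tr1 mulr_sumr; apply: ler_sum => j _.
  have [l lE] := psd_kernel_gram (psd1 j).
  have -> : H j j = \sum_(y <- l) \sum_i (\sum_k A i j k * y k) ^+ 2.
    rewrite [RHS]exchange_big /=; apply: eq_bigr => i _.
    under [RHS]eq_bigr do rewrite expr2 mulr_suml.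
    rewrite [RHS]exchange_big /=; apply: eq_bigr => k _.
    under [RHS]eq_bigr do rewrite mulr_sumr.
    rewrite [RHS]exchange_big /=; apply: eq_bigr => k' _.
    by rewrite lE mulr_sumr; apply: eq_bigr => y _; ring.
  have -> : \sum_k m j k j k = \sum_(y <- l) \sum_k y k ^+ 2.
    by rewrite [RHS]exchange_big /=; apply: eq_bigr => k _; rewrite lE.
  rewrite mulr_sumr; apply: ler_sum => y _.
  have := trilinear_sqr_le K0 tri (fun j' => (j' == j)%:R) y.
  have -> : \sum_i ((i == j)%:R : R) ^+ 2 = 1.
    by rewrite -[RHS](sum_delta j (fun=> 1)); apply: eq_bigr => i _; case: (i == j); rewrite ?mulr1 ?expr1n ?expr0n.
  rewrite mulr1; congr (_ <= _); apply: eq_bigr => i _; congr (_ ^+ 2).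
  rewrite -[RHS](sum_delta j (fun j' => \sum_k A i j' k * y k)); apply: eq_bigr => j' _.
  by rewrite mulr_sumr; apply: eq_bigr => k _; ring.
apply: offdiag_le_cuts => J.
have [l lE] := psd_kernel_gram psd2.
have -> : \sum_(j in J) \sum_(j' in ~: J) H j j' = \sum_(y <- l) cut_form A J y y.
  rewrite /cut_form [RHS]exchange_big /=; apply: eq_bigr => j _.
  rewrite [RHS]exchange_big /=; apply: eq_bigr => j' _.
  rewrite [RHS]exchange_big /=; apply: eq_bigr => i _.
  rewrite [RHS]exchange_big /=; apply: eq_bigr => k _.
  rewrite [RHS]exchange_big /=; apply: eq_bigr => k' _.
  rewrite (lE (j, j') (k, k')) mulr_sumr; apply: eq_bigr => y _; ring.
apply: (@le_trans _ _ (\sum_(y <- l) B * \sum_p y p ^+ 2)).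
  by apply: ler_sum => y _; apply: cut_form_diag_le => u v; exact: cut.
rewrite -mulr_sumr exchange_big /=.
rewrite [X in B * X](_ : _ = 1) ?mulr1// -[RHS]tr1.
rewrite (pair_bigA _ (fun j k => m j k j k)) /=.
by apply: eq_bigr => p _; rewrite msym (lE p p).
Qed.

End deterministic.

(** * Pseudo-expectations on the sphere *)

Section degree_bounds.
Context {R : idomainType} {n : nat}.
Implicit Types p q : {mpoly R[n]}.

Lemma deg_leW a b p : (a <= b)%N -> deg_le a p -> deg_le b p.
Proof. by move=> ab; rewrite /deg_le => /leq_trans; apply; rewrite ltnS. Qed.

Lemma deg_leM a b p q : deg_le a p -> deg_le b q -> deg_le (a + b) (p * q).
Proof.
rewrite /deg_le => pa qb; have [->|p0] := eqVneq p 0; first by rewrite mul0r msize0.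
have [->|q0] := eqVneq q 0; first by rewrite mulr0 msize0.
rewrite msizeM// -subn1 leq_subLR; apply: leq_trans (leq_add pa qb) _.
by rewrite addSn addnS add1n.
Qed.

Lemma deg_leD a p q : deg_le a p -> deg_le a q -> deg_le a (p + q).
Proof.
by move=> pa qa; apply: leq_trans (mmeasureD_le _ _ _) _; rewrite geq_max; apply/andP.
Qed.

Lemma deg_leZ a (c : R) p : deg_le a p -> deg_le a (c *: p).
Proof. by move=> pa; apply: leq_trans (msizeZ_le _ _) _. Qed.

Lemma deg_leB a p q : deg_le a p -> deg_le a q -> deg_le a (p - q).
Proof.
by move=> pa qa; apply: deg_leD => //; rewrite -scaleN1r; exact: deg_leZ.
Qed.

Lemma deg_le_sum a (I : finType) (Q : pred I) (F : I -> {mpoly R[n]}) :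
  (forall i, Q i -> deg_le a (F i)) -> deg_le a (\sum_(i | Q i) F i).
Proof.
move=> h; apply: (big_ind (fun p => deg_le a p)) => //; first by rewrite /deg_le msize0.
by move=> p q; exact: deg_leD.
Qed.

Lemma deg_leX (i : 'I_n) : deg_le 1 ('X_i : {mpoly R[n]}).
Proof. by have := msizeX R U_(i)%MM; rewrite /deg_le mdeg1 => ->. Qed.

Lemma deg_le1 a : deg_le a (1 : {mpoly R[n]}).
Proof. by rewrite /deg_le msize1. Qed.

End degree_bounds.

Definition linform (R : comRingType) (n : nat) (c : 'I_n -> R) : {mpoly R[n]} :=
  \sum_i c i *: 'X_i.

Definition sqnorm_poly (R : comRingType) (n : nat) : {mpoly R[n]} :=
  \sum_(i < n) 'X_i ^+ 2.

Lemma deg_le_linform (R : idomainType) n (c : 'I_n -> R) : deg_le 1 (linform c).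
Proof. by apply: deg_le_sum => i _; apply: deg_leZ; exact: deg_leX. Qed.

Lemma tensor_polyE (R : comRingType) n (A : tensor3 R n) :
  tensor_poly A = \sum_i 'X_i * \sum_j \sum_k A i j k *: ('X_j * 'X_k).
Proof.
apply: eq_bigr => i _; rewrite mulr_sumr; apply: eq_bigr => j _.
by rewrite mulr_sumr; apply: eq_bigr => k _; rewrite -scalerAr mulrA.
Qed.

Lemma deg_le_quadratic (R : idomainType) n (F : 'I_n -> 'I_n -> R) :
  deg_le 2 (\sum_j \sum_k F j k *: ('X_j * 'X_k) : {mpoly R[n]}).
Proof.
apply: deg_le_sum => j _; apply: deg_le_sum => k _; apply: deg_leZ.
by apply: (@deg_leM _ _ 1 1); exact: deg_leX.
Qed.

Lemma deg_le_tensor_poly (R : idomainType) n (A : tensor3 R n) :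
  deg_le 3 (tensor_poly A).
Proof.
rewrite tensor_polyE; apply: deg_le_sum => i _.
by apply: (@deg_leM _ _ 1 2); [exact: deg_leX|exact: deg_le_quadratic].
Qed.

Lemma deg_le_sqnorm (R : idomainType) n : deg_le 2 (sqnorm_poly R n).
Proof.
apply: deg_le_sum => i _; rewrite expr2.
by apply: (@deg_leM _ _ 1 1); exact: deg_leX.
Qed.

(* E is linear only up to degree 4; this linear functional agrees with E there. *)
Definition pe_linear (R : realFieldType) n (E : {mpoly R[n]} -> R)
    (p : {mpoly R[n]}) : R :=
  \sum_(m : 'X_{1..n < 5}) p@_m * E 'X_[m].

Fact pe_linear_is_linear (R : realFieldType) n (E : {mpoly R[n]} -> R) :
  linear_for *%R (pe_linear E).
Proof.
move=> a p q; rewrite /pe_linear mulr_sumr -big_split /=; apply: eq_bigr => m _.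
by rewrite mcoeffD mcoeffZ mulrDl mulrA.
Qed.

HB.instance Definition _ (R : realFieldType) n (E : {mpoly R[n]} -> R) :=
  GRing.isLinear.Build R {mpoly R[n]} R *%R (pe_linear E) (pe_linear_is_linear E).

Lemma pe_linearZ (R : realFieldType) n (E : {mpoly R[n]} -> R) (c : R) p :
  pe_linear E (c *: p) = c * pe_linear E p.
Proof. exact: linearZ. Qed.

Section pseudo_expectations.
Context {R : realType} {n : nat} (E : {mpoly R[n]} -> R).
Hypotheses (peE : pseudo_expectation 4 E) (sphE : pe_satisfies 4 E (sphere_poly R n)).
Local Notation L := (pe_linear E).

(** [E] is additive only in degree at most 4, so the induction over the monomial expansion carries
    the degree bound along with the value. *)
Lemma pe_linearE p : deg_le 4 p -> E p = L p.
Proof.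
move=> p4; have [ED EZ _ _] := peE.
have E0 : E 0 = 0.
  by have := EZ 0 0; rewrite scale0r mul0r; apply; rewrite /deg_le msize0.
have X4 (m : 'X_{1..n < 5}) : deg_le 4 ('X_[m] : {mpoly R[n]}).
  by rewrite /deg_le msizeX; exact: bmdeg.
rewrite [in LHS](mpolywE p4) /pe_linear.
suff [] : E (\sum_(m : 'X_{1..n < 5}) p@_m *: 'X_[m]) =
      \sum_(m : 'X_{1..n < 5}) p@_m * E 'X_[m] /\
    deg_le 4 (\sum_(m : 'X_{1..n < 5}) p@_m *: 'X_[m]) by [].
apply: (big_ind2 (fun q r => E q = r /\ deg_le 4 q)).
- by rewrite E0 /deg_le msize0.
- by move=> q1 r1 q2 r2 [<- d1] [<- d2]; rewrite ED//; split=> //; exact: deg_leD.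
- by move=> m _; rewrite EZ//; split=> //; exact: deg_leZ.
Qed.

Lemma pe_linear1 : L 1 = 1.
Proof. by rewrite -pe_linearE ?deg_le1//; case: peE. Qed.

Lemma pe_linear_sqr_ge0 p : deg_le 2 p -> 0 <= L (p ^+ 2).
Proof.
move=> p2; rewrite -pe_linearE; first by case: peE => _ _ _; apply.
by rewrite expr2; exact: (@deg_leM _ _ 2 2).
Qed.

Lemma pe_linear_sphere q : deg_le 2 q -> L (sqnorm_poly R n * q) = L q.
Proof.
move=> q2; apply/eqP; rewrite -subr_eq0 -raddfB /= -[X in _ - X]mul1r -mulrBl.
have d4 : deg_le 4 (sphere_poly R n * q).
  apply: (@deg_leM _ _ 2 2) => //; apply: deg_leB; first exact: deg_le_sqnorm.
  exact: deg_le1.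
by rewrite -pe_linearE// sphE.
Qed.

Lemma pe_linear_sqnorm : L (sqnorm_poly R n) = 1.
Proof. by rewrite -[sqnorm_poly R n]mulr1 pe_linear_sphere ?deg_le1// pe_linear1. Qed.

Lemma pe_linear_sqr_sum (D : finType) (c : D -> R) (P : D -> {mpoly R[n]}) :
  L ((\sum_p c p *: P p) ^+ 2) = \sum_p \sum_q c p * c q * L (P p * P q).
Proof.
rewrite expr2 mulr_suml raddf_sum; apply: eq_bigr => p _.
rewrite mulr_sumr raddf_sum; apply: eq_bigr => q _.
by rewrite -scalerAl -scalerAr /= !linearZ /= mulrA.
Qed.

Definition moment (i j k l : 'I_n) : R := L ('X_i * 'X_j * 'X_k * 'X_l).

(** By commutativity the entry at [p], [q] is [L (F p * F q)] for quadratic monomials [F], so the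
    form is [L] of a square. *)
Lemma moment_psd2 : psd_kernel (fun p q : 'I_n * 'I_n => moment p.1 q.1 p.2 q.2).
Proof.
split=> [p q|c]; first by rewrite /moment; congr (L _); ring.
pose F (p : 'I_n * 'I_n) : {mpoly R[n]} := 'X_(p.1) * 'X_(p.2).
pose P := \sum_p c p *: F p; have e : L (P ^+ 2) = _ := pe_linear_sqr_sum c F.
have P2 : deg_le 2 P.
  apply: deg_le_sum => p _; apply: deg_leZ.
  by apply: (@deg_leM _ _ 1 1); exact: deg_leX.
have := pe_linear_sqr_ge0 P2; rewrite e; congr (0 <= _).
apply: eq_bigr => p _; apply: eq_bigr => q _; rewrite /moment /F; congr (_ * L _); ring.
Qed.

Lemma moment_psd1 j : psd_kernel (fun k l => moment j k j l).
Proof.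
split=> [p q|c]; first by rewrite /moment; congr (L _); ring.
pose F (p : 'I_n) : {mpoly R[n]} := 'X_j * 'X_p.
pose P := \sum_p c p *: F p; have e : L (P ^+ 2) = _ := pe_linear_sqr_sum c F.
have P2 : deg_le 2 P.
  apply: deg_le_sum => p _; apply: deg_leZ.
  by apply: (@deg_leM _ _ 1 1); exact: deg_leX.
have := pe_linear_sqr_ge0 P2; rewrite e; congr (0 <= _).
by apply: eq_bigr => p _; apply: eq_bigr => q _; rewrite /moment /F mulrA.
Qed.

(** The fourth power of the norm has pseudo-expectation 1, by two uses of the sphere constraint. *)
Lemma moment_trace : \sum_j \sum_k moment j k j k = 1.
Proof.
rewrite -pe_linear_sqnorm -(pe_linear_sphere (deg_le_sqnorm R n)).
rewrite mulr_suml raddf_sum; apply: eq_bigr => j _.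
rewrite mulr_sumr raddf_sum; apply: eq_bigr => k _.
by rewrite /moment /=; congr (L _); ring.
Qed.

Lemma quartic_formE A : quartic_form A moment =
  \sum_i L ((\sum_j \sum_k A i j k *: ('X_j * 'X_k)) ^+ 2).
Proof.
pose G i (p : 'I_n * 'I_n) := A i p.1 p.2.
transitivity (\sum_i \sum_(p : 'I_n * 'I_n) \sum_(q : 'I_n * 'I_n)
   G i p * G i q * L ('X_(p.1) * 'X_(p.2) * ('X_(q.1) * 'X_(q.2)))).
  rewrite /quartic_form; under eq_bigr do rewrite exchange_big /=.
  rewrite exchange_big /=; apply: eq_bigr => i _.
  rewrite -(pair_bigA _ (fun j k => \sum_(q : 'I_n * 'I_n)
   A i j k * G i q * L ('X_j * 'X_k * ('X_(q.1) * 'X_(q.2))))) /=.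
  apply: eq_bigr => j _; rewrite exchange_big /=; apply: eq_bigr => k _.
  rewrite -(pair_bigA _ (fun j' k' =>
   A i j k * A i j' k' * L ('X_j * 'X_k * ('X_j' * 'X_k')))) /=.
  apply: eq_bigr => j' _; apply: eq_bigr => k' _.
  by rewrite /moment mulrA.
apply: eq_bigr => i _; rewrite -pe_linear_sqr_sum; congr (L (_ ^+ 2)).
by rewrite (pair_bigA _ (fun j k => A i j k *: ('X_j * 'X_k))).
Qed.

(* From 0 <= sum_i (l x_i - q_i(x))^2, where A(x) = sum_i x_i q_i(x). *)
Lemma pe_linear_tensor_le A (l : R) :
  2 * l * L (tensor_poly A) <= l ^+ 2 + quartic_form A moment.
Proof.
pose q i : {mpoly R[n]} := \sum_j \sum_k A i j k *: ('X_j * 'X_k).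
have : 0 <= \sum_i L ((l *: 'X_i - q i) ^+ 2).
  apply: sumr_ge0 => i _; apply: pe_linear_sqr_ge0; apply: deg_leB.
    by apply: deg_leZ; apply: deg_leW (deg_leX i).
  exact: deg_le_quadratic.
have -> : \sum_i L ((l *: 'X_i - q i) ^+ 2) =
    l ^+ 2 * L (sqnorm_poly R n) - 2 * l * L (tensor_poly A) + quartic_form A moment.
  rewrite quartic_formE tensor_polyE !raddf_sum !mulr_sumr -sumrB -big_split /=.
  apply: eq_bigr => i _; rewrite -/(q i).
  rewrite -linearZ /= -[2 * l * _]linearZ -raddfB -raddfD /=; congr (L _).
  by rewrite -!mul_mpolyC !expr2 !rmorphM /= rmorph_nat; ring.
rewrite pe_linear_sqnorm; lra.
Qed.

End pseudo_expectations.

(** * Spiked cubics and evaluation functionals *)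

Lemma linform_sqr_dist (R : realType) n (v : 'I_n -> R) : dotv v v = 1 ->
  \sum_i ('X_i - (v i)%:MP) ^+ 2 = sqnorm_poly R n - 2 * linform v + 1.
Proof.
move=> v1; rewrite [X in _ + X](_ : 1 = (\sum_i v i * v i)%:MP); last first.
  by rewrite -/(dotv v v) v1.
rewrite rmorph_sum mulr_sumr -sumrB -big_split /=; apply: eq_bigr => i _.
by rewrite rmorphM /= -mul_mpolyC; ring.
Qed.

Lemma tensor_poly_spike (R : comRingType) n (v : 'I_n -> R) :
  tensor_poly (fun i j k => v i * v j * v k) = linform v ^+ 3.
Proof.
rewrite exprS expr2 [in RHS]/linform mulr_suml; apply: eq_bigr => i _.
rewrite mulr_suml mulr_sumr; apply: eq_bigr => j _.
rewrite !mulr_sumr; apply: eq_bigr => k _.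
by rewrite -!mul_mpolyC !rmorphM /=; ring.
Qed.

Lemma tensor_polyD (R : comRingType) n (A B : tensor3 R n) :
  tensor_poly (fun i j k => A i j k + B i j k) = tensor_poly A + tensor_poly B.
Proof.
rewrite -big_split /=; apply: eq_bigr => i _; rewrite -big_split /=.
apply: eq_bigr => j _; rewrite -big_split /=; apply: eq_bigr => k _.
by rewrite scalerDl.
Qed.

Lemma tensor_polyZ (R : comRingType) n (a : R) (A : tensor3 R n) :
  tensor_poly (fun i j k => a * A i j k) = a *: tensor_poly A.
Proof.
rewrite scaler_sumr /=; apply: eq_bigr => i _; rewrite scaler_sumr.
apply: eq_bigr => j _; rewrite scaler_sumr; apply: eq_bigr => k _.
by rewrite scalerA.
Qed.

Lemma tensor_poly_spiked (R : comRingType) n (tau : R) (v : 'I_n -> R) (A : tensor3 R n) :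
  tensor_poly (spiked tau v A) = tau *: linform v ^+ 3 + tensor_poly A.
Proof.
rewrite -tensor_poly_spike -tensor_polyZ -tensor_polyD; congr tensor_poly.
by apply/funext => i; apply/funext => j; apply/funext => k; rewrite /spiked !mulrA.
Qed.

Lemma meval_tensor_poly (R : comRingType) n (A : tensor3 R n) (v : 'I_n -> R) :
  meval v (tensor_poly A) = \sum_i \sum_j \sum_k A i j k * v i * v j * v k.
Proof.
rewrite /tensor_poly rmorph_sum; apply: eq_bigr => i _.
rewrite rmorph_sum; apply: eq_bigr => j _; rewrite rmorph_sum; apply: eq_bigr => k _.
by rewrite /= mevalZ !mevalM !mevalXU !mulrA.
Qed.

Lemma meval_linform (R : comRingType) n (c v : 'I_n -> R) :
  meval v (linform c) = dotv c v.
Proof.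
by rewrite /linform rmorph_sum; apply: eq_bigr => i _; rewrite /= mevalZ mevalXU.
Qed.

(** Point evaluations are the competitors with which a maximizer is compared. *)
Lemma meval_pseudo_expectation (R : realType) n d (v : 'I_n -> R) :
  pseudo_expectation d (meval v).
Proof.
split=> [p q _ _|c p _||p _]; first exact: mevalD.
- exact: mevalZ.
- exact: meval1.
- by rewrite rmorphXn /= sqr_ge0.
Qed.

Lemma meval_satisfies_sphere (R : realType) n d (v : 'I_n -> R) : dotv v v = 1 ->
  pe_satisfies d (meval v) (sphere_poly R n).
Proof.
move=> v1 q _; rewrite mevalM /sphere_poly mevalB meval1 rmorph_sum /=.
rewrite (eq_bigr (fun i => v i * v i)) => [|i _]; last by rewrite rmorphXn /= mevalXU.
by rewrite -/(dotv v v) v1 subrr mul0r.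
Qed.

Section spike_recovery.
Context {R : realType} {n : nat} (E : {mpoly R[n]} -> R).
Hypotheses (peE : pseudo_expectation 4 E) (sphE : pe_satisfies 4 E (sphere_poly R n)).
Local Notation L := (pe_linear E).

Lemma pe_meanE i : pe_mean E i = L 'X_i.
Proof. by rewrite /pe_mean (pe_linearE peE)//; apply: deg_leW (deg_leX i). Qed.

(** The variance of each coordinate is nonnegative, and the second moments sum to 1 on the
    sphere. *)
Lemma pe_mean_sqr_le1 : \sum_i pe_mean E i ^+ 2 <= 1.
Proof.
rewrite -(pe_linear_sqnorm peE sphE) raddf_sum /=; apply: ler_sum => i _.
rewrite pe_meanE; set a := L 'X_i.
have d1 : deg_le 2 ('X_i - a *: 1 : {mpoly R[n]}).
  by apply: deg_leB; [exact: deg_leW (deg_leX i)|apply: deg_leZ; exact: deg_le1].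
have := pe_linear_sqr_ge0 peE d1.
have -> : ('X_i - a *: 1) ^+ 2 = 'X_i ^+ 2 - (2 * a) *: 'X_i + (a ^+ 2) *: 1 :> {mpoly R[n]}.
  by rewrite -!mul_mpolyC !expr2 !rmorphM /= rmorph_nat; ring.
rewrite raddfD raddfB /= !pe_linearZ -/a (pe_linear1 peE); lra.
Qed.

Lemma pe_linear_linform v : L (linform v) = dotv (pe_mean E) v.
Proof.
rewrite /linform raddf_sum; apply: eq_bigr => i _.
by rewrite /= pe_linearZ pe_meanE mulrC.
Qed.

(* Uses (1 - t)(t + 1/2)^2 = (1 + 3t)/4 - t^3, and on the sphere
   1 - <x, v> = |x - v|^2 / 2. *)
Lemma pe_linear_cube_le (v : 'I_n -> R) : dotv v v = 1 ->
  L (linform v ^+ 3) <= 4^-1 + 3 / 4 * L (linform v).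
Proof.
move=> v1; set t := linform v.
have t1 : deg_le 1 t := deg_le_linform v.
pose w : {mpoly R[n]} := t + t + 1.
have w1 : deg_le 1 w by apply: deg_leD; [exact: deg_leD|exact: deg_le1].
have : 0 <= L ((\sum_i ('X_i - (v i)%:MP) ^+ 2) * w ^+ 2).
  rewrite mulr_suml raddf_sum; apply: sumr_ge0 => i _.
  rewrite -exprMn; apply: (pe_linear_sqr_ge0 peE); apply: (@deg_leM _ _ 1 1) => //.
  apply: deg_leB; first exact: deg_leX.
  by rewrite -[_%:MP]mulr1 mul_mpolyC; apply: deg_leZ; exact: deg_le1.
rewrite linform_sqr_dist// -/t -addrA mulrDl raddfD /=.
rewrite (pe_linear_sphere peE sphE); last by rewrite expr2; exact: (@deg_leM _ _ 1 1).
rewrite -raddfD /=.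
(* With [w = 2 t + 1] the left side is [2 (1 - t) (2 t + 1) ^ 2]. *)
have -> : w ^+ 2 + (- (2 * t) + 1) * w ^+ 2 = (2 : R) *: 1 + (6 : R) *: t - (8 : R) *: t ^+ 3.
  by rewrite /w !scaler_nat; ring.
rewrite raddfB raddfD /= !pe_linearZ (pe_linear1 peE); lra.
Qed.

(** Optimality gives [1 - c <= 2 B / tau] for the pseudo-expected cube [c], and [c <= 1/4 + 3/4 s]
    gives [1 - s <= 4/3 (1 - c)]; hence the constant [8 / 3]. *)
Lemma spike_correlation (A : tensor3 R n) (v : 'I_n -> R) (tau B : R) :
  dotv v v = 1 -> 0 < tau ->
  (forall E' : {mpoly R[n]} -> R, pseudo_expectation 4 E' ->
     pe_satisfies 4 E' (sphere_poly R n) -> E' (tensor_poly A) <= B) ->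
  (forall E' : {mpoly R[n]} -> R, pseudo_expectation 4 E' ->
     pe_satisfies 4 E' (sphere_poly R n) ->
     E' (tensor_poly (spiked tau v A)) <= E (tensor_poly (spiked tau v A))) ->
  1 - 8 / 3 * (B / tau) <= dotv (pe_mean E) v.
Proof.
move=> v1 tau0 bnd opt.
(* The cubic is odd, so the upper bound at [- v] is a lower bound at [v]. *)
have vN1 : dotv (fun i => - v i) (fun i => - v i) = 1.
  by rewrite -v1; apply: eq_bigr => i _; rewrite mulrNN.
have b1 := bnd _ peE sphE.
have b2 := bnd _ (meval_pseudo_expectation 4 _) (meval_satisfies_sphere vN1).
have := opt _ (meval_pseudo_expectation 4 v) (meval_satisfies_sphere v1).
rewrite [leRHS](pe_linearE peE); last exact: deg_leW (deg_le_tensor_poly _).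
rewrite (pe_linearE peE) in b1; last exact: deg_leW (deg_le_tensor_poly _).
rewrite tensor_poly_spiked mevalD mevalZ rmorphXn /= meval_linform v1 expr1n mulr1.
rewrite raddfD /= pe_linearZ.
have -> : meval v (tensor_poly A) = - meval (fun i => - v i) (tensor_poly A).
  rewrite !meval_tensor_poly -sumrN; apply: eq_bigr => i _; rewrite -sumrN.
  by apply: eq_bigr => j _; rewrite -sumrN; apply: eq_bigr => k _; ring.
move=> h; have := pe_linear_cube_le v1; rewrite pe_linear_linform.
set s := dotv _ _; set c := L (linform v ^+ 3) in h *; move=> cs.
have key : tau * (1 - c) <= 2 * B by lra.
have : 1 - c <= 2 * (B / tau) by rewrite mulrA ler_pdivlMr// mulrC.
lra.
Qed.

End spike_recovery.

(** If [s] is nonnegative, division by a norm at most 1 cannot decrease it. If [s < 0] then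
    [delta > 1], and Cauchy-Schwarz gives [s / |m| >= -1 >= 1 - 2 delta]; this case is why [delta]
    is doubled. *)
Lemma normalize_correlation (R : realType) n (m v : 'I_n -> R) (delta : R) :
  dotv v v = 1 -> \sum_i m i ^+ 2 <= 1 -> 0 <= delta -> 1 - delta <= dotv m v ->
  1 - 2 * delta <= dotv (normalize m) v.
Proof.
move=> v1 m1 d0 h; set s := dotv m v in h *.
have mE : dotv m m = \sum_i m i ^+ 2 by apply: eq_bigr => i _; rewrite expr2.
have mm0 : 0 <= dotv m m by rewrite mE sumr_ge0// => i _; exact: sqr_ge0.
have nE : dotv (normalize m) v = s / normv m.
  by rewrite /s /dotv mulr_suml; apply: eq_bigr => i _; rewrite /normalize mulrAC.
have nm1 : normv m <= 1 by rewrite -[leRHS]sqrtr1 ler_wsqrtr// mE.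
have CS : s ^+ 2 <= dotv m m.
  have sqE a : \sum_i (m i - a * v i) ^+ 2 = dotv m m - 2 * a * s + a ^+ 2.
    rewrite [X in _ + X](_ : _ = a ^+ 2 * dotv v v); last by rewrite v1 mulr1.
    rewrite /s /dotv !mulr_sumr -sumrB -big_split /=.
    by apply: eq_bigr => i _; ring.
  have : 0 <= \sum_i (m i - s * v i) ^+ 2 by apply: sumr_ge0 => i _; exact: sqr_ge0.
  by rewrite sqE; lra.
(* If the mean vanishes, [invr0] makes the normalized vector 0; then [s = 0] and [delta >= 1]. *)
have [nm0|nmn0] := eqVneq (normv m) 0.
  rewrite nE nm0 invr0 mulr0.
  have mm : dotv m m = 0 by rewrite -(sqr_sqrtr mm0) -/(normv m) nm0 expr0n.
  rewrite mm in CS.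
  have s0 : s = 0 by apply/eqP; rewrite -sqrf_eq0 eq_le CS sqr_ge0.
  by rewrite s0 in h; lra.
have nmp : 0 < normv m by rewrite lt_def nmn0 sqrtr_ge0.
rewrite nE; have [s0|s0] := leP 0 s.
  apply: (@le_trans _ _ s); first lra.
  by rewrite ler_pdivlMr// ler_piMr.
apply: (@le_trans _ _ (-1)); first lra.
rewrite ler_pdivlMr// mulN1r -[s]opprK lerN2.
by apply: (le_trans (ler_norm _)); rewrite normrN -sqrtr_sqr; exact: ler_wsqrtr.
Qed.

(** * Invariance of the cubic under permutations of the indices *)

Lemma tensor_poly_swap12 (R : comRingType) n (A : tensor3 R n) :
  tensor_poly (fun i j k => A j i k) = tensor_poly A.
Proof.
rewrite /tensor_poly exchange_big /=; apply: eq_bigr => i _; apply: eq_bigr => j _.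
by apply: eq_bigr => k _; rewrite ['X_j * 'X_i]mulrC.
Qed.

Lemma tensor_poly_swap23 (R : comRingType) n (A : tensor3 R n) :
  tensor_poly (fun i j k => A i k j) = tensor_poly A.
Proof.
rewrite /tensor_poly; apply: eq_bigr => i _; rewrite exchange_big /=.
by apply: eq_bigr => j _; apply: eq_bigr => k _; rewrite mulrAC.
Qed.

Lemma tensor_poly_perm (R : comRingType) n (A : tensor3 R n) (s : 'S_3) :
  tensor_poly (tensor_perm A s) = tensor_poly A.
Proof.
have ne (a b : nat) : (a < 3)%N -> (b < 3)%N -> a != b ->
    (s (inord a) : nat) != s (inord b).
  move=> a3 b3 ab; rewrite (inj_eq val_inj) (inj_eq perm_inj) -(inj_eq val_inj) /=.
  by rewrite !inordK.
have n01 := ne 0 1 isT isT isT; have n02 := ne 0 2 isT isT isT.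
have n12 := ne 1 2 isT isT isT.
have -> : tensor_perm A s = fun i j k => A (nth i [:: i; j; k] (s (inord 0)))
    (nth i [:: i; j; k] (s (inord 1))) (nth i [:: i; j; k] (s (inord 2))).
  apply/funext => i; apply/funext => j; apply/funext => k.
  by rewrite /tensor_perm !(tnth_nth i).
have w12 := @tensor_poly_swap12 R n; have w23 := @tensor_poly_swap23 R n.
move: n01 n02 n12.
(* Distinctness leaves six cases. The identity and the two adjacent swaps close at once; the two
   3-cycles and the exchange of the outer indices remain. *)
case: (s (inord 0)) => -[|[|[|//]]] p0; case: (s (inord 1)) => -[|[|[|//]]] p1;
  case: (s (inord 2)) => -[|[|[|//]]] p2 //= _ _ _.
- exact: etrans (w12 (fun i j k => A i k j)) (w23 A).
- exact: etrans (w23 (fun i j k => A j i k)) (w12 A).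
- exact: etrans (w12 (fun i j k => A k i j)) (etrans (w23 (fun i j k => A j i k)) (w12 A)).
Qed.

Lemma tensor_poly_sum (R : comRingType) n (I : finType) (T : I -> tensor3 R n) :
  tensor_poly (fun i j k => \sum_s T s i j k) = \sum_s tensor_poly (T s).
Proof.
rewrite /tensor_poly [RHS]exchange_big /=; apply: eq_bigr => i _.
rewrite [RHS]exchange_big /=; apply: eq_bigr => j _.
rewrite [RHS]exchange_big /=; apply: eq_bigr => k _.
by rewrite scaler_suml.
Qed.

Lemma tensor_poly_spiked_sym (R : numFieldType) n (tau : R) (v : 'I_n -> R)
    (A : tensor3 R n) :
  tensor_poly (spiked_sym tau v A) = tensor_poly (spiked tau v A).
Proof.
rewrite /spiked_sym /spiked !tensor_polyD; congr (_ + _).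
rewrite tensor_polyZ tensor_poly_sum (eq_bigr (fun=> tensor_poly A)); last first.
  by move=> s _; exact: tensor_poly_perm.
by rewrite sumr_const card_Sn -scaler_nat scalerA mulVf ?scale1r// pnatr_eq0.
Qed.

(** * The Gaussian tensor *)

Lemma union_bound (d : measure_display) (T : measurableType d) (R : realType)
    (P : probability T R) (I : eqType) (s : seq I) (F : I -> set T) (p : R) :
  (forall i, measurable (F i)) -> (forall i, i \in s -> (P (F i) <= p%:E)%E) ->
  (P (\big[setU/set0]_(i <- s) F i) <= ((size s)%:R * p)%:E)%E.
Proof.
move=> mF; elim: s => [_|i s IHs Fp]; first by rewrite big_nil measure0 mul0r.
rewrite big_cons /= mulrSr addrC mulrDl mul1r EFinD.
have mU : measurable (\big[setU/set0]_(j <- s) F j) by exact: bigsetU_measurable.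
apply: le_trans (measureU2 P (mF i) mU) _.
apply: leeD; first by apply: Fp; rewrite mem_head.
by apply: IHs => j js; apply: Fp; rewrite inE js orbT.
Qed.

(** * The cut form as a decoupled Gaussian chaos *)

Section triple_sums.
Context {R : realType} {n : nat}.
Local Notation I := ('I_n * 'I_n * 'I_n)%type.
Implicit Types (B : tensor3 R n) (J : {set 'I_n}) (u v : 'I_n * 'I_n -> R).

Lemma triple_sum (F : 'I_n -> 'I_n -> 'I_n -> R) :
  \sum_i \sum_j \sum_k F i j k = \sum_(a : I) F a.1.1 a.1.2 a.2.
Proof.
rewrite (pair_bigA _ (fun i j => \sum_k F i j k)) /=.
by rewrite (pair_bigA _ (fun (p : 'I_n * 'I_n) k => F p.1 p.2 k)).
Qed.

Definition row_cut J : {set I} := [set a : I | a.1.2 \in J]%SET.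

Definition chaos_coef u v (a b : I) : R :=
  (a.1.1 == b.1.1)%:R * u (a.1.2, b.1.2) * v (a.2, b.2).

Lemma chaos_inner B J u v (a : I) :
  \sum_(b in ~: row_cut J) chaos_coef u v a b * B b.1.1 b.1.2 b.2 =
  \sum_j' \sum_k' B a.1.1 j' k' * ((j' \in ~: J)%:R * u (a.1.2, j')) * v (a.2, k').
Proof.
rewrite big_mkcond /=.
pose F i' j' k' := if j' \in ~: J then
  (a.1.1 == i')%:R * u (a.1.2, j') * v (a.2, k') * B i' j' k' else 0.
rewrite (eq_bigr (fun b : I => F b.1.1 b.1.2 b.2)); last first.
  by move=> b _; rewrite /F /chaos_coef /row_cut !inE.
rewrite -triple_sum (bigD1 a.1.1) //= [X in _ + X]big1 ?addr0; last first.
  move=> i /negPf ia; rewrite big1// => j' _; rewrite big1// => k' _.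
  by rewrite /F eq_sym ia !mul0r if_same.
apply: eq_bigr => j' _; apply: eq_bigr => k' _; rewrite /F eqxx.
by case: (j' \in ~: J) => /=; ring.
Qed.

Lemma cut_form_chaos B J u v : cut_form B J u v =
  \sum_(a in row_cut J) B a.1.1 a.1.2 a.2 *
    \sum_(b in ~: row_cut J) chaos_coef u v a b * B b.1.1 b.1.2 b.2.
Proof.
under [RHS]eq_bigr do rewrite chaos_inner.
rewrite [RHS]big_mkcond /=.
pose F i j k := if j \in J then B i j k *
  \sum_j' \sum_k' B i j' k' * ((j' \in ~: J)%:R * u (j, j')) * v (k, k') else 0.
rewrite [RHS](eq_bigr (fun b : I => F b.1.1 b.1.2 b.2)); last first.
  by move=> b _; rewrite /F /chaos_coef /row_cut !inE.
rewrite -triple_sum exchange_big /= /cut_form big_mkcond /=.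
apply: eq_bigr => j _; rewrite /F.
case: (j \in J); last by rewrite big1// => i _; rewrite big1.
rewrite big_mkcond /=.
rewrite (eq_bigr (fun j' => \sum_i \sum_k \sum_k' B i j k *
   (B i j' k' * ((j' \in ~: J)%:R * u (j, j')) * v (k, k')))); last first.
  move=> j' _; case: (j' \in ~: J).
    by apply: eq_bigr => i _; apply: eq_bigr => k _; apply: eq_bigr => k' _ /=; ring.
  rewrite big1// => i _; rewrite big1// => k _; rewrite big1// => k' _.
  by rewrite mul0r mulr0 mul0r mulr0.
rewrite exchange_big /=; apply: eq_bigr => i _.
rewrite exchange_big /=; apply: eq_bigr => k _.
by rewrite mulr_sumr; apply: eq_bigr => j' _; rewrite mulr_sumr.
Qed.

(** For fixed [j] and [k] the coefficients form, as [i] varies, the contraction of [B] with the row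
    [u (j, _)] restricted outside [J] and the row [v (k, _)]. The bound [trilinear_sqr_le] applies
    to each, and summing over [j] and [k] restores the two norms. *)
Lemma chaos_variance_le B J u v (K : R) : 0 <= K ->
  (forall x y z : 'I_n -> R, \sum_i x i ^+ 2 <= 1 -> \sum_i y i ^+ 2 <= 1 ->
    \sum_i z i ^+ 2 <= 1 -> trilinear B x y z <= K) ->
  \sum_(a in row_cut J)
    (\sum_(b in ~: row_cut J) chaos_coef u v a b * B b.1.1 b.1.2 b.2) ^+ 2 <=
  K ^+ 2 * (\sum_p u p ^+ 2) * (\sum_p v p ^+ 2).
Proof.
move=> K0 tri.
pose y j j' := (j' \in ~: J)%:R * u (j, j').
pose F i j k := (\sum_j' \sum_k' B i j' k' * y j j' * v (k, k')) ^+ 2.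
apply: (@le_trans _ _ (\sum_i \sum_j \sum_k F i j k)).
  rewrite triple_sum big_mkcond /=; apply: ler_sum => a _.
  by case: ifP => _; rewrite ?chaos_inner// sqr_ge0.
rewrite exchange_big /=; under eq_bigr do rewrite exchange_big /=.
have -> : \sum_p u p ^+ 2 = \sum_j \sum_j' u (j, j') ^+ 2.
  by rewrite (pair_bigA _ (fun j j' => u (j, j') ^+ 2)); apply: eq_bigr; case.
have -> : \sum_p v p ^+ 2 = \sum_k \sum_k' v (k, k') ^+ 2.
  by rewrite (pair_bigA _ (fun j j' => v (j, j') ^+ 2)); apply: eq_bigr; case.
rewrite [K ^+ 2 * _]mulr_sumr mulr_suml; apply: ler_sum => j _.
set s := K ^+ 2 * \sum_j' u (j, j') ^+ 2.
rewrite mulr_sumr; apply: ler_sum => k _; rewrite {}/s.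
apply: le_trans (trilinear_sqr_le K0 tri _ _) _.
have v0 : 0 <= \sum_k' v (k, k') ^+ 2 by apply: sumr_ge0 => k' _; exact: sqr_ge0.
apply: ler_wpM2r => //; apply: ler_wpM2l; first exact: sqr_ge0.
apply: ler_sum => j' _; rewrite /y; case: (j' \in ~: J); rewrite ?mul1r// mul0r.
by rewrite expr0n /= sqr_ge0.
Qed.

End triple_sums.

(** * Tail bounds and the good event *)

Section gaussian_tensor.
Context {d : measure_display} {T : measurableType d} {R : realType}.
Context (P : probability T R) {n : nat}.
Context (A : 'I_n -> 'I_n -> 'I_n -> {RV P >-> R}).
Hypothesis A_normal : forall i j k (B : set R), measurable B ->
  distribution P (A i j k) B = normal_prob 0 1 B.
Hypothesis A_indep : mutually_independent P
  (fun ijk : 'I_n * 'I_n * 'I_n => (A ijk.1.1 ijk.1.2 ijk.2 : T -> _)).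
Local Notation I := ('I_n * 'I_n * 'I_n)%type.
Local Notation At w := (fun i j k => A i j k w).

Let X (a : I) : {RV P >-> R} := A a.1.1 a.1.2 a.2.

(** The variance is the product of the three squared norms, at most 64. *)
Lemma trilinear_tail (x y z : 'I_n -> R) (t : R) : 0 < t ->
  \sum_i x i ^+ 2 <= 4 -> \sum_i y i ^+ 2 <= 4 -> \sum_i z i ^+ 2 <= 4 ->
  (P [set w | (t <= trilinear (At w) x y z)%R] <= (expR (- (t ^+ 2 / 128)))%:E)%E.
Proof.
move=> t0 x4 y4 z4.
have cs : \sum_(a : I) (x a.1.1 * y a.1.2 * z a.2) ^+ 2 <= 64.
  rewrite -(triple_sum (fun i j k => (x i * y j * z k) ^+ 2)).
  have -> : \sum_i \sum_j \sum_k (x i * y j * z k) ^+ 2 =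
     (\sum_i x i ^+ 2) * (\sum_j y j ^+ 2) * (\sum_k z k ^+ 2).
    rewrite 2!mulr_suml; apply: eq_bigr => i _; rewrite -mulrA mulr_suml mulr_sumr.
    apply: eq_bigr => j _; rewrite !mulr_sumr; apply: eq_bigr => k _.
    by rewrite !exprMn mulrA.
  have nn (w : 'I_n -> R) : 0 <= \sum_p w p ^+ 2.
    by apply: sumr_ge0 => p _; exact: sqr_ge0.
  apply: (@le_trans _ _ (4 * 4 * 4)); last by rewrite -!natrM.
  by apply: ler_pM => //; [exact: mulr_ge0|exact: ler_pM].
have p64 : 0 < 64 :> R by rewrite ltr0n.
have := gaussian_tail (X := X) (fun a => A_normal a.1.1 a.1.2 a.2) A_indep t0 p64 cs.
have -> : 2 * 64 = 128 :> R by rewrite -natrM.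
congr (P _ <= _)%E; apply/seteqP; split=> w /=; congr (_ <= _);
  by rewrite /trilinear triple_sum; apply: eq_bigr => a _; rewrite /X; ring.
Qed.

Lemma measurable_trilinear (x y z : 'I_n -> R) :
  measurable_fun [set: T] (fun w => trilinear (At w) x y z).
Proof.
apply: measurable_sum => i; apply: measurable_sum => j; apply: measurable_sum => k.
by do 3!apply: measurable_funM => //.
Qed.

(** The conditional variance bound is part of the event, so its probability is controlled
    unconditionally; the trilinear bound later ensures that this part holds. *)
Definition cut_event (J : {set 'I_n}) (u v : 'I_n * 'I_n -> R) (t s : R) : set T :=
  [set w | t <= \sum_(a in row_cut J) X a w *
              \sum_(b in ~: row_cut J) chaos_coef u v a b * X b w /\
           \sum_(a in row_cut J)
              (\sum_(b in ~: row_cut J) chaos_coef u v a b * X b w) ^+ 2 <= s].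

Lemma measurable_cut_event J u v t s : measurable (cut_event J u v t s).
Proof.
apply: (measurable_decoupled_event X (row_cut J)
  (f := fun a w => \sum_(b in ~: row_cut J) chaos_coef u v a b * X b w)) => a.
have -> : (fun w => \sum_(b in (~: row_cut J)%SET) chaos_coef u v a b * X b w) =
    (fun w => \sum_b if b \in (~: row_cut J)%SET then chaos_coef u v a b * X b w else 0).
  by apply/funext => w; rewrite big_mkcond.
by apply: measurable_sum => b; case: (boolP (b \in _)) => // _; exact: measurable_funM.
Qed.

Lemma cut_event_tail J u v t s : 0 < t -> 0 < s ->
  (P (cut_event J u v t s) <= (expR (- (t ^+ 2 / (2 * s))))%:E)%E.
Proof.
exact: (decoupled_chaos_tail (X := X) (fun a => A_normal a.1.1 a.1.2 a.2) A_indep).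
Qed.

(** Since [expR 1 >= 2], the sixth power is at least 64. *)
Lemma expR6_ge48 : 48 <= expR 6 :> R.
Proof.
have -> : 6 = 6%:R * 1 :> R by rewrite mulr1.
rewrite expRM_natl; apply: (@le_trans _ _ (2 ^+ 6)).
  by rewrite -natrX ler_nat.
apply: lerXn2r; rewrite ?nnegrE ?expR_ge0//.
exact: (expR_ge1Dx (1 : R)).
Qed.

Lemma exp48_le (m : nat) : 48 ^+ m <= expR (m%:R * 6) :> R.
Proof.
rewrite expRM_natl; apply: lerXn2r; rewrite ?nnegrE ?expR_ge0//.
exact: expR6_ge48.
Qed.

(* Failure probabilities: 48^(3n) exp (- K^2 / 128) <= exp (- n) for the trilinear
   form, and 2^n 48^(2 n^2) exp (- t^2 / (2 s)) <= exp (- n^2) for the cuts. *)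
Lemma gaussian_tensor_good : (0 < n)%N ->
  exists G : set T, [/\ measurable G,
    ((1 - 2 * expR (- n%:R))%:E <= P G)%E &
    forall w, G w ->
      (forall x y z : 'I_n -> R, \sum_i x i ^+ 2 <= 1 -> \sum_i y i ^+ 2 <= 1 ->
        \sum_i z i ^+ 2 <= 1 -> trilinear (At w) x y z <= 50 * Num.sqrt n%:R) /\
      (forall J (u v : 'I_n * 'I_n -> R), \sum_p u p ^+ 2 <= 1 ->
        \sum_p v p ^+ 2 <= 1 ->
        cut_form (At w) J u v <= 1100 * (n%:R * Num.sqrt n%:R))].
Proof.
move=> n0.
have N1 : 1 <= n%:R :> R by rewrite ler1n.
have N0 : 0 < n%:R :> R by apply: lt_le_trans N1.
set r := Num.sqrt n%:R; have r0 : 0 < r by rewrite sqrtr_gt0.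
have r2 : r ^+ 2 = n%:R by rewrite sqr_sqrtr// ltW.
(* [K ^+ 2 / 128] exceeds [19 n], of which [18 n] pays for the triples of net points. The 16 in [s]
   is [4 * 4], from the squared norms of two net points, and [t ^+ 2 / (2 * s) = 121 / 8 n ^ 2]
   exceeds [12 n ^ 2 + 2 n]. *)
pose K := 50 * r; pose t := 1100 * (n%:R * r); pose s := 16 * K ^+ 2.
have K0 : 0 < K by apply: mulr_gt0; rewrite ?ltr0n.
have t0 : 0 < t by apply: mulr_gt0; [rewrite ltr0n|exact: mulr_gt0].
have s0 : 0 < s by apply: mulr_gt0; [rewrite ltr0n|exact: exprn_gt0].
have [sn [szn sn4 netn]] := finite_linear_net R 'I_n.
have [sm [szm sm4 netm]] := finite_linear_net R ('I_n * 'I_n)%type.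
rewrite card_ord in szn; rewrite card_prod card_ord in szm.
pose s1 := [seq (p, z) | p <- [seq (x, y) | x <- sn, y <- sn], z <- sn].
pose s2 := [seq (J, p) | J <- enum {set 'I_n}, p <- [seq (u, v) | u <- sm, v <- sm]].
pose V := {ffun 'I_n -> R}; pose W := {ffun 'I_n * 'I_n -> R}.
pose F1 (p : V * V * V) : set T := [set w | K <= trilinear (At w) p.1.1 p.1.2 p.2].
pose F2 (p : {set 'I_n} * (W * W)) : set T := cut_event p.1 p.2.1 p.2.2 t s.
have mF1 p : measurable (F1 p).
  rewrite -[F1 p]setTI; apply: measurable_fun_le => //.
  exact: measurable_trilinear.
have mF2 p : measurable (F2 p) by exact: measurable_cut_event.
pose Bad1 := \big[setU/set0]_(p <- s1) F1 p.
pose Bad2 := \big[setU/set0]_(p <- s2) F2 p.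
have mB1 : measurable Bad1 by exact: bigsetU_measurable.
have mB2 : measurable Bad2 by exact: bigsetU_measurable.
have mB : measurable (Bad1 `|` Bad2) by exact: measurableU.
exists (~` (Bad1 `|` Bad2)); split; first exact: measurableC.
- have P1 : (P Bad1 <= (expR (- n%:R))%:E)%E.
    apply: le_trans (union_bound (p := expR (- (K ^+ 2 / 128))) mF1 _) _.
      move=> p /allpairsP[[q z] /= [+ zs ->]] => /allpairsP[[x y] /= [xs ys ->]].
      by apply: trilinear_tail => //=; apply: sn4.
    rewrite lee_fin.
    have sz : (size s1)%:R <= expR ((n * 3)%N%:R * 6) :> R.
      rewrite !size_allpairs; apply: le_trans (exp48_le _); rewrite exprM.
      rewrite -[48 ^+ n]natrX -natrX ler_nat !expnS expn0 muln1 mulnA.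
      by do 2!apply: leq_mul => //.
    apply: (le_trans (ler_wpM2r (expR_ge0 _) sz)).
    rewrite -expRD ler_expR natrM /K exprMn r2.
    lra.
  have P2 : (P Bad2 <= (expR (- n%:R))%:E)%E.
    apply: le_trans (union_bound (p := expR (- (t ^+ 2 / (2 * s)))) mF2 _) _.
      by move=> p _; exact: cut_event_tail.
    rewrite lee_fin.
    have sz : (size s2)%:R <= expR (n%:R * 1) * expR ((n * n * 2)%N%:R * 6) :> R.
      rewrite !size_allpairs -cardE -cardsT -powersetT card_powerset cardsT card_ord natrM.
      apply: ler_pM => //.
        rewrite natrX expRM_natl; apply: lerXn2r; rewrite ?nnegrE ?expR_ge0//.
        exact: (expR_ge1Dx (1 : R)).
      apply: le_trans (exp48_le _); rewrite exprM.
      rewrite -[48 ^+ _]natrX -natrX ler_nat !expnS expn0 muln1.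
      by apply: leq_mul.
    apply: (le_trans (ler_wpM2r (expR_ge0 _) sz)).
    have -> : t ^+ 2 / (2 * s) = 121 / 8 * (n%:R * n%:R).
      rewrite /s /t /K !exprMn r2 expr2; field.
      by rewrite gt_eqF.
    rewrite -!expRD ler_expR !natrM.
    have := ler_wpM2r (ltW N0) N1; lra.
  rewrite probability_setC//.
  have : (P (Bad1 `|` Bad2) <= (2 * expR (- n%:R))%:E)%E.
    apply: le_trans (measureU2 P mB1 mB2) _.
    rewrite mulrDl mul1r EFinD; exact: leeD.
  move=> h; rewrite EFinB; exact: leeB.
- move=> w Gw.
  have nF1 p : p \in s1 -> ~ F1 p w.
    by move=> ps Fp; apply: Gw; left; rewrite /Bad1 -bigcup_seq; exists p.
  have nF2 p : p \in s2 -> ~ F2 p w.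
    by move=> ps Fp; apply: Gw; right; rewrite /Bad2 -bigcup_seq; exists p.
  have tri : forall x y z : 'I_n -> R, \sum_i x i ^+ 2 <= 1 -> \sum_i y i ^+ 2 <= 1 ->
        \sum_i z i ^+ 2 <= 1 -> trilinear (At w) x y z <= K.
    apply: (trilinear_net netn) => x y z xs ys zs.
    have := nF1 (x, y, z); rewrite /F1 /= => h.
    rewrite leNgt; apply/negP => lt; apply: h; last exact: ltW.
    by apply/allpairsP; exists ((x, y), z); split=> //; apply/allpairsP; exists (x, y).
  split => // J; apply: (cut_form_net netm) => u v us vs.
  have := nF2 (J, (u, v)); rewrite /F2 /= => h.
  rewrite leNgt; apply/negP => lt; apply: h.
    apply/allpairsP; exists (J, (u, v)); split=> //=; first by rewrite mem_enum.
    by apply/allpairsP; exists (u, v).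
  (* A cut form above [t] would put [w] in [F2], since the variance condition follows from the
     trilinear bound [tri]. *)
  split; first by apply: ltW; rewrite cut_form_chaos in lt.
  apply: le_trans (chaos_variance_le J u v (ltW K0) tri) _.
  rewrite /s [16 * _]mulrC -mulrA.
  apply: ler_wpM2l; first exact: sqr_ge0.
  apply: (@le_trans _ _ (4 * 4)); last by rewrite -natrM.
  by apply: ler_pM; rewrite ?sumr_ge0 ?sm4// => p _; exact: sqr_ge0.
Qed.

End gaussian_tensor.

(** * Recovery of the spike with high probability *)

Unset Implicit Arguments.
Set Strict Implicit.
Set Printing Implicit Defensive.

Theorem mainTheorem4 (R : realType) :
  exists C K1 K2 : R,
  forall (n : nat) (v0 : 'I_n -> R) (eps tau : R),
    dotv v0 v0 = 1 ->
    0 < eps ->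
    C * powR (n%:R) (3 / 4) * powR (ln (n%:R)) (1 / 4) / eps <= tau ->
  forall (d : measure_display) (T : measurableType d)
         (P : probability T R)
         (A : 'I_n -> 'I_n -> 'I_n -> {RV P >-> R}),
    (forall i j k (B : set R), measurable B ->
       distribution P (A i j k) B = normal_prob 0 1 B) ->
    mutually_independent P
      (fun ijk : 'I_n * 'I_n * 'I_n => (A ijk.1.1 ijk.1.2 ijk.2 : T -> _)) ->
  exists G : set T,
    [/\ measurable G,
        ((1 - K1 * n%:R ^- 10)%:E <= P G)%E &
        forall w, G w ->
        forall S : tensor3 R n,
          S = spiked tau v0 (fun i j k => A i j k w) \/
          S = spiked_sym tau v0 (fun i j k => A i j k w) ->
        forall E : {mpoly R[n]} -> R,
          pseudo_expectation 4 E ->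
          pe_satisfies 4 E (sphere_poly _ n) ->
          (forall E' : {mpoly R[n]} -> R,
              pseudo_expectation 4 E' ->
              pe_satisfies 4 E' (sphere_poly _ n) ->
              E' (tensor_poly S) <= E (tensor_poly S)) ->
          1 - K2 * eps <= dotv (normalize (pe_mean E)) v0].
Proof.
(* C = 1 suffices because the logarithmic factor is not needed. *)
exists 1, (2 * 10`!%:R), 448 => n v0 eps tau v1 eps0 tau_ge d T P A A_normal A_indep.
(* For [n < 4] the claimed probability is nonpositive, because [3 ^ 10 <= 2 * 10!], and the empty
   event suffices; [n = 0] admits no unit vector. From [n = 4] on, [ln n >= 1]. *)
have [n4|n4] := ltnP n 4.
  exists set0; split; [exact: measurable0| |by []].
  rewrite measure0 lee_fin subr_le0.
  have n0 : (0 < n)%N.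
    case: (n) v0 v1 {tau_ge A A_normal A_indep} => // v0.
    by rewrite /dotv big_ord0 => /eqP; rewrite eq_sym oner_eq0.
  rewrite ler_pdivlMr ?exprn_gt0 ?ltr0n// mul1r -natrX -natrM ler_nat.
  apply: (@leq_trans (3 ^ 10)); first by rewrite leq_exp2r.
  by rewrite !factS fact0.
have n0 : (0 < n)%N by apply: leq_trans n4.
have N4 : 4 <= n%:R :> R by rewrite ler_nat.
have N0 : 0 < n%:R :> R by rewrite ltr0n.
have [G [mG PG Ggood]] := gaussian_tensor_good A_normal A_indep n0.
exists G; split=> //.
  apply: le_trans PG; rewrite lee_fin lerD2l lerN2 -mulrA ler_wpM2l//.
  rewrite expRN -[leRHS]invrK lef_pV2 ?posrE ?expR_gt0//; last first.
    by rewrite invr_gt0 mulr_gt0 ?invr_gt0 ?exprn_gt0 ?ltr0n ?fact_gt0.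
  (* The Taylor term of order 10, [n ^ 10 / 10!], is the source of the power in the failure
     probability. *)
  have := expR_ge1Dxn 9 (ltW N0); apply: le_trans.
  by rewrite invfM invrK mulrC lerDr.
move=> w Gw S hS E peE sphE opt.
pose Aw : tensor3 R n := fun i j k => A i j k w.
have SE : tensor_poly S = tensor_poly (spiked tau v0 Aw).
  by case: hS => ->; rewrite ?tensor_poly_spiked_sym.
rewrite SE in opt.
have [tri cut] := Ggood w Gw.
set N : R := n%:R in N0 N4 tau_ge tri cut *.
pose r := Num.sqrt N; pose h := powR N (3 / 4).
have r1 : 1 <= r by rewrite -[leLHS]sqrtr1 ler_wsqrtr//; apply: le_trans N4; rewrite ler1n.
have h0 : 0 < h by rewrite powR_gt0.
have h2 : h ^+ 2 = N * r.
  have N0' : N != 0 by rewrite gt_eqF.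
  rewrite /h /r -powR12_sqrt ?ltW// expr2 -[X in X * N `^ 2^-1]powRr1 ?ltW//.
  by rewrite -!powRD ?N0' ?implybT//; congr powR; field.
have bnd E' : pseudo_expectation 4 E' -> pe_satisfies 4 E' (sphere_poly R n) ->
    E' (tensor_poly Aw) <= 84 * h.
  move=> pe' sph'.
  rewrite (pe_linearE pe'); last exact: deg_leW (deg_le_tensor_poly _).
  have K0 : 0 <= 50 * r by apply: mulr_ge0; rewrite ?ler0n// sqrtr_ge0.
  have msym j k : moment E' j k j k = moment E' j j k k.
    by rewrite /moment; congr (pe_linear _ _); ring.
  have Q : quartic_form Aw _ <= _ := quartic_form_le K0 tri cut (moment_psd2 pe') (moment_psd1 pe')
    msym (moment_trace pe' sph').
  (* With [l = 84 * h] and the quartic form at most [l ^ 2], this reads [2 l E A <= 2 l ^ 2]. *)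
  have lin := pe_linear_tensor_le pe' sph' Aw (84 * h).
  have B0 : 0 < 2 * (84 * h) by apply: mulr_gt0; [rewrite ltr0n|apply: mulr_gt0; rewrite ?ltr0n].
  rewrite -(ler_pM2l B0); apply: (le_trans lin).
  (* As [r ^ 2 = N <= N * r = h ^ 2], the left side is at most [(2500 + 4400) h ^ 2], and
     [84 ^ 2 = 7056]. *)
  have : (50 * r) ^+ 2 + 4 * (1100 * (N * r)) <= (84 * h) ^+ 2.
    rewrite !exprMn h2 sqr_sqrtr ?ltW//.
    have : N <= N * r by rewrite ler_peMr// ltW.
    lra.
  move=> hM; apply: le_trans (lerD (lexx _) (le_trans Q hM)) _.
  by rewrite le_eqVlt; apply/orP; left; apply/eqP; ring.
have ln1 : 1 <= powR (ln N) (1 / 4).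
  have : 1 <= ln N.
    rewrite -ler_expR lnK ?posrE//; apply: le_trans N4.
    (* [expR 1 <= 4] follows by squaring; the half power is bounded through
       [expR (- 1/2) >= 1/2]. *)
    have e2 : expR (2^-1 : R) <= 2.
      rewrite -[leLHS]invrK -expRN invf_ple ?posrE ?expR_gt0 ?ltr0n//.
      by apply: le_trans (expR_ge1Dx _); lra.
    rewrite [X in expR X](_ : 1 = 2^-1 + 2^-1); last by field.
    rewrite expRD; apply: (le_trans (ler_pM (expR_ge0 _) (expR_ge0 _) e2 e2)).
    by rewrite -natrM.
  move=> l1; rewrite -[leLHS](_ : powR 1 (1 / 4) = 1); last by rewrite powR1.
  by apply: ge0_ler_powR; rewrite ?nnegrE ?divr_ge0// (le_trans _ l1).
have htau : h / eps <= tau.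
  apply: le_trans tau_ge; rewrite mul1r ler_pM2r ?invr_gt0//.
  by rewrite ler_peMr// ltW.
have tau0 : 0 < tau by apply: lt_le_trans htau; exact: divr_gt0.
have corr := spike_correlation peE sphE v1 tau0 bnd opt.
have Bt : 84 * h / tau <= 84 * eps.
  rewrite ler_pdivrMr// -mulrA ler_wpM2l ?ler0n//.
  by rewrite mulrC -ler_pdivrMr.
(* [224 = 8 / 3 * 84]; the factor 2 is the cost of normalizing the mean. *)
have -> : 448 * eps = 2 * (224 * eps) by ring.
apply: normalize_correlation => //.
- exact: pe_mean_sqr_le1.
- by apply: mulr_ge0; rewrite ?ler0n// ltW.
- by apply: le_trans corr; lra.
Qed.
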